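(* Let $X$ be a separable real Banach space which admits a $C^{1}$-smooth norm. Let $Y\subset X$ be a closed subspace, and let $f:Y\rightarrow\mathbb{R}$ be a $C^{1}$-smooth function. Then there is a $C^{1}$-smooth function $g:X\rightarrow\mathbb{R}$ such that $g(y)=f(y)$ for all $y\in Y$.
   Context: Smoothness is in the Fréchet sense: a real-valued function on a Banach space is $C^1$-smooth if it is Fréchet differentiable everywhere and its derivative is norm-to-norm continuous into the dual; for $f:Y\to\mathbb{R}$ the derivative takes values in $Y^*$, and for a function on $X$ it takes values in $X^*$. ''$X$ admits a $C^1$-smooth norm'' means that $X$ has an equivalent norm which is $C^1$-smooth on $X\setminus\{0\}$. ''Subspace'' means linear subspace, with the norm inherited from $X$ (it is not assumed to be complemented). *)

(* Defs.v *)
From HB Require Import structures.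
From mathcomp Require Import all_boot all_order all_algebra.
From mathcomp Require Import all_classical all_reals all_analysis.

Set Implicit Arguments.
Unset Strict Implicit.
Unset Printing Implicit Defensive.

Import Order.TTheory GRing.Theory Num.Theory.
Import numFieldNormedType.Exports.

Local Open Scope classical_set_scope.
Local Open Scope ring_scope.

Definition separable (T : topologicalType) : Prop :=
  exists2 D : set T, countable D & dense D.

Section C1.
Context {R : realType} {V : normedModType R}.

(* The norm of the dual space.  [sup] is a genuine least upper bound only when
   phi is bounded on the unit ball, as every continuous linear phi is. *)
Definition dual_norm (phi : V -> R) : R :=
  sup [set `|phi v| | v in [set v : V | `|v| <= 1]].

(* Frechet differentiability at every point of U, with a derivative that is
   continuous from U, with the norm of V, to the dual of V, with its norm.
   Meant for an open U. *)
Definition C1_on (U : set V) (f : V -> R) : Prop :=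
  (forall x, U x -> differentiable f x) /\
  (forall x, U x ->
    dual_norm (fun v => 'd f y v - 'd f x v) @[y --> within U (nbhs x)] --> 0).

Definition C1 (f : V -> R) : Prop := C1_on setT f.

Record is_norm (N : V -> R) : Prop := IsNorm {
  is_norm_triangle : forall x y, N (x + y) <= N x + N y ;
  is_norm_homogeneous : forall (a : R) x, N (a *: x) = `|a| * N x ;
  is_norm_definite : forall x, N x = 0 -> x = 0
}.

Definition equivalent_to_norm (N : V -> R) : Prop :=
  exists c C : R, [/\ 0 < c, 0 < C & forall x, c * `|x| <= N x <= C * `|x|].

End C1.

Definition admits_C1_norm {R : realType} (V : normedModType R) : Prop :=
  exists N : V -> R,
    [/\ is_norm N, equivalent_to_norm N & C1_on (~` [set 0]) N].

(* A linear subspace as a normed space in its own right, with the inherited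
   norm. *)
Section Subspace.
Context {R : realType} {V : normedModType R} (Y : submodClosed V).

Definition subspace_of : Type := {y : V | y \in Y}.

HB.instance Definition _ := SubChoice.on subspace_of.
HB.instance Definition _ := [SubChoice_isSubLmodule of subspace_of by <:].

Let norm (y : subspace_of) : R := `|\val y|.

Let ler_normD x y : norm (x + y) <= norm x + norm y.
Proof. by rewrite /norm raddfD ler_normD. Qed.

Let normrZ (a : R) x : norm (a *: x) = `|a| * norm x.
Proof. by rewrite /norm linearZ /= normrZ. Qed.

Let normr0_eq0 x : norm x = 0 -> x = 0.
Proof. by move=> /normr0_eq0 x0; apply: val_inj; rewrite raddf0. Qed.

HB.instance Definition _ :=
  Lmodule_isNormed.Build R subspace_of ler_normD normrZ normr0_eq0.

End Subspace.

(* Main.v *)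
From HB Require Import structures.
Require Import Defs.
From mathcomp Require Import all_boot all_order all_algebra.
From mathcomp Require Import all_classical all_reals all_analysis.
From mathcomp Require Import ring lra.

Set Implicit Arguments.
Unset Strict Implicit.
Unset Printing Implicit Defensive.

Import Order.TTheory GRing.Theory Num.Theory.
Import numFieldNormedType.Exports.

Local Open Scope classical_set_scope.
Local Open Scope ring_scope.

(* A function is C^1 iff it is strictly differentiable at every point: near
   each x, it is the sum of a continuous linear map and of a function with an
   arbitrarily small Lipschitz constant. This turns the proof into one about
   Lipschitz estimates.
   - By Hahn-Banach and the argument of Bartle and Graves, y |-> f'(y) lifts to
     a norm continuous map T from Y to the dual of X.
   - Locally, f and T are bounded and
       F x = inf_y f y + T_y (x - y) + sup_z rho(y, z) (2|x - y| - |z - y|)^+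
               + |x - y|^2 / (1 + |x - y|),
     with rho(y, z) = |f z - f y - T_y (z - y)| / |z - y|, is a Lipschitz
     extension of f that is strictly differentiable at each y in Y, with
     derivative T_y.
   - On a separable space with a C^1 norm, a K-Lipschitz function is a uniform
     limit of C^1 functions that are O(K)-Lipschitz. Used off Y with a
     partition of unity, this makes F smooth there within |x - y|^2, without
     spoiling the strict differentiability at the points y of Y.
   - A partition of unity glues the local extensions. *)

(** * Strict differentiability: calculus and mean value inequality *)

Section StrictDifferentiability.
Context {R : realType} {V : normedModType R}.
Implicit Types (f g L : V -> R) (x y : V) (K e : R).

(** The difficulty of the whole proof is the derivative, not the values. A smooth approximation of
    an extension [F] off the subspace can be as close to [F] as desired and still have a derivative
    that does not tend to [T_y] at the subspace. Smoothing on a separable space costs a fixed factor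
    in the Lipschitz constant, here [5 * C]. Applied to [F] itself this says nothing about
    convergence of the derivative; applied to [F] minus a well chosen functional, whose Lipschitz
    constant is small near the subspace, it leaves that constant small. Hence [F] has to be strictly
    differentiable on the subspace, not merely differentiable, before it is smoothed elsewhere. As
    no projection onto the subspace is at hand, derivatives are lifted one at a time, and a separate
    argument makes the lift continuous. In the formula for [F], each function under the infimum
    touches [f] at its [y] and dominates [f] on the subspace; the last summand makes distant [y]
    lose the infimum near a given point. *)

Definition bounded_linear L :=
  (forall a u v, L (a *: u + v) = a * L u + L v) /\
  exists2 K, 0 < K & forall v, `|L v| <= K * `|v|.

Definition lip_near x K f :=
  \forall z \near (x, x), `|f z.1 - f z.2| <= K * `|z.1 - z.2|.

Definition sdiff f x L :=
  bounded_linear L /\ forall e, 0 < e -> lip_near x e (f \- L).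

Definition smooth f := forall x, exists L, sdiff f x L.

Lemma near_both x (P : V -> Prop) :
  (\forall z \near x, P z) -> \forall z \near (x, x), P z.1 /\ P z.2.
Proof. by move=> xP; exists (P, P) => // -[a b] [/=]. Qed.

Lemma near_diag x (P : V * V -> Prop) :
  (\forall z \near (x, x), P z) ->
  exists2 d, 0 < d & forall a b, `|a - x| < d -> `|b - x| < d -> P (a, b).
Proof.
move=> [[A B] /= [/nbhs_ballP[d /= d0 dA] /nbhs_ballP[d' /= d'0 dB]] ABP].
exists (Num.min d d'); first by rewrite lt_min d0.
move=> a b; rewrite !lt_min => /andP[ad _] /andP[_ bd]; apply: ABP; split => /=.
  by apply: dA; rewrite -ball_normE /= distrC.
by apply: dB; rewrite -ball_normE /= distrC.
Qed.

Lemma near_norm x d : 0 < d -> \forall z \near x, `|z - x| < d.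
Proof.
by move=> d0; apply/nbhs_ballP; exists d => //= y; rewrite -ball_normE /= distrC.
Qed.

Lemma norm_near x (P : V -> Prop) : (\forall z \near x, P z) ->
  exists2 d, 0 < d & forall z, `|z - x| < d -> P z.
Proof.
move=> /nbhs_ballP[d /= d0 dP]; exists d => // z zx; apply: dP.
by rewrite -ball_normE /= distrC.
Qed.

Lemma lin0 L : bounded_linear L -> L 0 = 0.
Proof. by move=> [lL _]; have := lL (-1) 0 0; rewrite scaler0 addr0 mulN1r addNr. Qed.

Lemma linD L u v : bounded_linear L -> L (u + v) = L u + L v.
Proof. by move=> [lL _]; have := lL 1 u v; rewrite scale1r mul1r. Qed.

Lemma linZ L a u : bounded_linear L -> L (a *: u) = a * L u.
Proof. by move=> bL; have := bL.1 a u 0; rewrite !addr0 (lin0 bL) addr0. Qed.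

Lemma linB L u v : bounded_linear L -> L (u - v) = L u - L v.
Proof. by move=> bL; rewrite linD // -scaleN1r linZ // mulN1r. Qed.

Lemma bounded_linear0 : bounded_linear (fun _ => 0).
Proof.
split; first by move=> a u v; rewrite mulr0 addr0.
by exists 1 => // v; rewrite normr0 mul1r.
Qed.

Lemma bounded_linearD L1 L2 :
  bounded_linear L1 -> bounded_linear L2 -> bounded_linear (L1 \+ L2).
Proof.
move=> [l1 [K1 K10 b1]] [l2 [K2 K20 b2]]; split.
  by move=> a u v /=; rewrite l1 l2; ring.
exists (K1 + K2) => [|v /=]; first lra.
rewrite (le_trans (ler_normD _ _))// mulrDl; exact: lerD.
Qed.

Lemma bounded_linearZ c L : bounded_linear L -> bounded_linear (fun v => c * L v).
Proof.
move=> [l [K K0 b]]; split; first by move=> a u v /=; rewrite l; ring.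
exists ((`|c| + 1) * K) => [|v]; first by rewrite mulr_gt0 // ltr_wpDl.
rewrite normrM -mulrA ler_pM // ?lerDl //.
Qed.

Lemma bounded_linearB L1 L2 :
  bounded_linear L1 -> bounded_linear L2 -> bounded_linear (L1 \- L2).
Proof.
move=> b1 b2; have := bounded_linearD b1 (bounded_linearZ (-1) b2).
by congr bounded_linear; apply/funext => v /=; rewrite mulN1r.
Qed.

Lemma lip_nearD x K1 K2 f g :
  lip_near x K1 f -> lip_near x K2 g -> lip_near x (K1 + K2) (f \+ g).
Proof.
apply: filterS2 => -[a b] /= fab gab; rewrite opprD addrACA mulrDl.
by rewrite (le_trans (ler_normD _ _)) // lerD.
Qed.

Lemma lip_near_eq x K f g : (\forall z \near x, f z = g z) ->
  lip_near x K f -> lip_near x K g.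
Proof. by move=> /near_both; apply: filterS2 => z [-> ->]. Qed.

Lemma lip_nearT x K f : (forall a b, `|f a - f b| <= K * `|a - b|) -> lip_near x K f.
Proof. by move=> fK; apply: filterE => z; exact: fK. Qed.

Lemma lip_near_lin x L : bounded_linear L -> exists2 K, 0 < K & lip_near x K L.
Proof.
by move=> bL; have [K K0 LK] := bL.2; exists K => //; apply: lip_nearT => a b;
  rewrite -linB.
Qed.

Lemma sdiff_lip f x L : sdiff f x L -> exists2 K, 0 < K & lip_near x K f.
Proof.
move=> [bL /(_ 1 ltr01) fL]; have [K K0 LK] := lip_near_lin x bL.
exists (1 + K); first lra.
have := lip_nearD fL LK; apply: lip_near_eq; near=> z => /=; rewrite subrK //.
Unshelve. all: by end_near. Qed.

Lemma lip_near_cvg f x K : lip_near x K f -> f z @[z --> x] --> f x.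
Proof.
move=> /near_diag[d d0 fK]; apply/cvgrPdist_le => e e0.
have K1 : 0 < `|K| + 1 by rewrite ltr_wpDl.
have ed : 0 < Num.min d (e / (`|K| + 1)) by rewrite lt_min d0 divr_gt0.
move: (near_norm x ed); apply: filterS => z; rewrite lt_min => /andP[zd ze].
rewrite distrC; have /= := fK z x zd; rewrite subrr normr0 => /(_ d0) /le_trans; apply.
have KK := ler_norm K.
move: ze; rewrite ltr_pdivlMr // => /ltW ze; apply: le_trans ze.
rewrite mulrC ler_wpM2l //; lra.
Qed.

Lemma sdiff_cvg f x L : sdiff f x L -> f z @[z --> x] --> f x.
Proof. by move=> /sdiff_lip[K _]; exact: lip_near_cvg. Qed.

Lemma sdiff_eq f g x L : (\forall z \near x, f z = g z) ->
  sdiff f x L -> sdiff g x L.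
Proof.
move=> fg [bL fL]; split=> // e /fL; apply: lip_near_eq.
by move: fg; apply: filterS => z /= ->.
Qed.

Lemma sdiff_lin L x : bounded_linear L -> sdiff L x L.
Proof.
move=> bL; split => // e e0; apply: lip_nearT => a b /=.
by rewrite !subrr normr0 mulr_ge0 // ltW.
Qed.

Lemma sdiff_cst c x : sdiff (fun _ => c) x (fun _ => 0).
Proof.
split=> [|e e0]; first exact: bounded_linear0.
by apply: lip_nearT => a b /=; rewrite !subrr normr0 mulr_ge0 // ltW.
Qed.

Lemma sdiffD f g x L1 L2 : sdiff f x L1 -> sdiff g x L2 ->
  sdiff (f \+ g) x (L1 \+ L2).
Proof.
move=> [b1 fL] [b2 gL]; split=> [|e e0]; first exact: bounded_linearD.
have e2 : 0 < e / 2 by rewrite divr_gt0.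
have := lip_nearD (fL _ e2) (gL _ e2); rewrite -splitr; apply: lip_near_eq.
by apply: filterE => z /=; ring.
Qed.

(** The first hypothesis is strict differentiability of [phi] at [f x] with slope [c]. The error is
    that of [phi], scaled by a local Lipschitz constant of [f], plus [c] times that of [f]. *)
Lemma sdiff_comp (phi : R -> R) c f x L :
  (forall e, 0 < e -> \forall z \near (f x, f x),
     `|phi z.1 - phi z.2 - c * (z.1 - z.2)| <= e * `|z.1 - z.2|) ->
  sdiff f x L -> sdiff (phi \o f) x (fun v => c * L v).
Proof.
move=> phic fL; have [bL fe] := fL; split=> [|e e0]; first exact: bounded_linearZ.
have [K K0 fK] := sdiff_lip fL.
have e1 : 0 < e / 2 / K by rewrite !divr_gt0.
have e2 : 0 < e / 2 / (`|c| + 1) by rewrite !divr_gt0 // ltr_wpDl.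
have cf := sdiff_cvg fL.
have {}phic : \forall z \near (x, x), `|phi (f z.1) - phi (f z.2)
    - c * (f z.1 - f z.2)| <= e / 2 / K * `|f z.1 - f z.2|.
  have [[A B] /= [fA fB] AB] := phic _ e1.
  exists ([set z | A (f z)], [set z | B (f z)]) => /=.
    by split; [exact: cf fA|exact: cf fB].
  by move=> [a b] /= [Aa Bb]; apply: (AB (f a, f b)); split.
near=> z.
have h1 : `|f z.1 - f z.2| <= K * `|z.1 - z.2| by near: z.
have h2 : `|phi (f z.1) - phi (f z.2) - c * (f z.1 - f z.2)|
   <= e / 2 / K * `|f z.1 - f z.2| by near: z.
have h3 : `|(f z.1 - L z.1) - (f z.2 - L z.2)| <=
    e / 2 / (`|c| + 1) * `|z.1 - z.2| by near: z; exact: fe.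
rewrite /= (_ : _ - _ - (_ - _) = (phi (f z.1) - phi (f z.2) - c * (f z.1 - f z.2)) +
  c * ((f z.1 - L z.1) - (f z.2 - L z.2))); last by ring.
rewrite (le_trans (ler_normD _ _)) // (splitr e) mulrDl; apply: lerD.
  rewrite (le_trans h2) // (le_trans (ler_wpM2l (ltW e1) h1)) //.
  by rewrite mulrA divfK // gt_eqF.
rewrite normrM.
apply: (@le_trans _ _ ((`|c| + 1) * (e / 2 / (`|c| + 1) * `|z.1 - z.2|))).
  by rewrite ler_pM // lerDl.
by rewrite mulrA mulrCA divff ?mulr1 // gt_eqF // ltr_wpDl.
Unshelve. all: by end_near. Qed.

Lemma sdiffZ c f x L : sdiff f x L -> sdiff (fun z => c * f z) x (fun v => c * L v).
Proof.
apply: (@sdiff_comp (fun t => c * t)) => e e0; apply: filterE => z /=.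
by rewrite mulrBr subrr normr0 mulr_ge0 // ltW.
Qed.

Lemma sdiffB f g x L1 L2 : sdiff f x L1 -> sdiff g x L2 ->
  sdiff (f \- g) x (L1 \- L2).
Proof.
move=> fL gL; have := sdiffD fL (sdiffZ (-1) gL).
by congr sdiff; apply/funext => z /=; rewrite mulN1r.
Qed.

Lemma sdiff_sqr f x L : sdiff f x L ->
  sdiff (fun z => f z ^+ 2) x (fun v => 2 * f x * L v).
Proof.
apply: (@sdiff_comp (fun t => t ^+ 2)) => e e0.
have e2 : 0 < e / 2 by rewrite divr_gt0.
have nf : \forall t \near f x, `|t - f x| < e / 2.
  by apply/nbhs_ballP; exists (e / 2) => //= y; rewrite /ball /= distrC.
have : \forall z \near (f x, f x), `|z.1 - f x| < e / 2 /\ `|z.2 - f x| < e / 2.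
  by exists ([set t | `|t - f x| < e / 2], [set t | `|t - f x| < e / 2]) => // -[].
apply: filterS => -[a b] /= [ha hb].
rewrite (_ : _ - _ - _ = ((a - f x) + (b - f x)) * (a - b)); last by ring.
rewrite normrM ler_wpM2r // (le_trans (ler_normD _ _)) // (splitr e).
by apply: lerD; exact: ltW.
Qed.

(** By polarization, [f g] is a quarter of the difference of the squares of [f + g] and [f - g]. *)
Lemma sdiffM f g x L1 L2 : sdiff f x L1 -> sdiff g x L2 ->
  sdiff (f \* g) x (fun v => f x * L2 v + g x * L1 v).
Proof.
move=> fL gL.
have := sdiffZ 4^-1 (sdiffB (sdiff_sqr (sdiffD fL gL)) (sdiff_sqr (sdiffB fL gL))).
by congr sdiff; apply/funext => z /=; lra.
Qed.

Lemma smooth_cst c : smooth (fun _ => c).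
Proof. by move=> x; eexists; exact: sdiff_cst. Qed.

Lemma smoothD f g : smooth f -> smooth g -> smooth (f \+ g).
Proof.
by move=> sf sg x; have [[L1 fL] [L2 gL]] := (sf x, sg x); eexists; exact: sdiffD fL gL.
Qed.

Lemma smoothM f g : smooth f -> smooth g -> smooth (f \* g).
Proof.
by move=> sf sg x; have [[L1 fL] [L2 gL]] := (sf x, sg x); eexists; exact: sdiffM fL gL.
Qed.

Lemma smoothB f g : smooth f -> smooth g -> smooth (f \- g).
Proof.
by move=> sf sg x; have [[L1 fL] [L2 gL]] := (sf x, sg x); eexists; exact: sdiffB fL gL.
Qed.

Lemma smoothZ c f : smooth f -> smooth (fun z => c * f z).
Proof. by move=> sf x; have [L fL] := sf x; eexists; exact: sdiffZ fL. Qed.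

(** For small [t], [L (t *: v)] is an increment of [f] up to an arbitrarily small multiple of the
    norm of [t *: v]; homogeneity then removes [t]. *)
Lemma sdiff_le f x L K : sdiff f x L -> lip_near x K f ->
  forall v, `|L v| <= K * `|v|.
Proof.
move=> [bL fL] fK v.
apply/ler_addgt0Pr => e e0.
have [->|v0] := eqVneq v 0.
  by rewrite (lin0 bL) !normr0 mulr0 add0r ltW.
have nv0 : 0 < `|v| by rewrite normr_gt0.
have e1 : 0 < e / `|v| by rewrite divr_gt0.
have [d d0 /=] := near_diag (filterI (fL _ e1) fK).
pose t := d / 2 / `|v|; have t0 : 0 < t by rewrite !divr_gt0.
have tvd : `|t *: v| < d.
  by rewrite normrZ gtr0_norm // divfK ?gt_eqF //; lra.
clearbody t.
have E : x + t *: v - x = t *: v by rewrite addrAC subrr add0r.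
move=> /(_ (x + t *: v) x); rewrite E subrr normr0 => /(_ tvd d0) [] /=.
set A := f _ - L _ - _; set B := f _ - f _ => hA hB.
have : `|L (t *: v)| <= e / `|v| * `|t *: v| + K * `|t *: v|.
  rewrite (_ : L (t *: v) = B - A); last first.
    by rewrite /A /B (linD x _ bL); ring.
  by rewrite (le_trans (ler_normB _ _)) // addrC lerD.
rewrite linZ // normrM normrZ (gtr0_norm t0) !(mulrCA _ t) -mulrDr ler_pM2l //.
by rewrite divfK ?gt_eqF // addrC.
Qed.

(** Let [m] be the supremum of the [t] at which the estimate from 0 holds. The hypothesis at [m]
    carries the estimate up to [m] and, if [m < 1], beyond it. *)
Lemma local_lip_real (phi : R -> R) K :
  (forall t : R, 0 <= t <= 1 -> \forall s \near t, `|phi s - phi t| <= K * `|s - t|) ->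
  `|phi 1 - phi 0| <= K.
Proof.
move=> phiK.
pose S := [set t | 0 <= t <= 1 /\ `|phi t - phi 0| <= K * t].
have S0 : S 0 by rewrite /S /= lexx ler01 subrr normr0 mulr0.
have hS : has_sup S.
  by split; [exists 0|exists 1 => t [/andP[]]].
pose m := sup S.
have m01 : 0 <= m <= 1.
  apply/andP; split; first exact: (sup_upper_bound hS).
  by apply: (ge_sup hS.1) => t [/andP[]].
have /nbhs_ballP[d /= d0 dK] := phiK m m01.
have {}dK s : `|s - m| < d -> `|phi s - phi m| <= K * `|s - m|.
  by move=> sm; apply: dK; rewrite /ball /= distrC.
have Sm : S m.
  split => //; have [s Ss ms] := sup_adherent d0 hS; have [s01 hs] := Ss.
  have sm : s <= m by exact: (sup_upper_bound hS).
  have : `|s - m| < d by rewrite ler0_norm; rewrite -/m in ms; lra.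
  move=> /dK; rewrite (distrC s) (distrC (phi s)) [`|m - s|]ger0_norm ?subr_ge0 // => h.
  rewrite (_ : phi m - _ = (phi m - phi s) + (phi s - phi 0)); last by ring.
  by rewrite (le_trans (ler_normD _ _)) // (le_trans (lerD h hs)) //; lra.
have [m1|m1] := ltP m 1; last first.
  have m1' : m = 1 by apply/eqP; rewrite eq_le m1; case/andP: m01 => _ ->.
  by have := Sm.2; rewrite m1' mulr1.
pose s := Num.min 1 (m + d / 2).
have ms : m < s by rewrite lt_min m1; lra.
have sd : s <= m + d / 2 by rewrite ge_min lexx orbT.
have s1 : s <= 1 by rewrite ge_min lexx.
suff Ss : S s by have := sup_upper_bound hS Ss; rewrite leNgt ms.
split; first by apply/andP; split => //; case/andP: m01; lra.
have : `|s - m| < d by rewrite ger0_norm; lra.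
move=> /dK; rewrite [`|s - m|]ger0_norm ?subr_ge0; last exact: ltW.
move=> h; rewrite (_ : phi s - _ = (phi s - phi m) + (phi m - phi 0)); last by ring.
by rewrite (le_trans (ler_normD _ _)) // (le_trans (lerD h Sm.2)) //; lra.
Qed.

(** A mean value inequality without derivatives: [f] is only compared, at each point of the segment,
    with its values nearby. *)
Lemma local_lip_segment f K a b :
  (forall t : R, 0 <= t <= 1 -> \forall z \near b + t *: (a - b),
    `|f z - f (b + t *: (a - b))| <= K * `|z - (b + t *: (a - b))|) ->
  `|f a - f b| <= K * `|a - b|.
Proof.
move=> fK; pose phi (t : R) := f (b + t *: (a - b)).
rewrite (_ : f a = phi 1); last by rewrite /phi scale1r subrKC.
rewrite (_ : f b = phi 0); last by rewrite /phi scale0r addr0.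
apply: local_lip_real => t /fK h.
have : (fun s : R => b + s *: (a - b)) @ t --> b + t *: (a - b).
  by apply: cvgD; [exact: cvg_cst|apply: cvgZr_tmp].
move=> /(_ _ h); rewrite /= nbhs_simpl /=; apply: filterS => s /=.
rewrite /phi => /le_trans; apply.
by rewrite opprD addrACA subrr add0r -scalerBl normrZ mulrA mulrAC.
Qed.

Lemma segment_ball x d a b (t : R) : `|a - x| < d -> `|b - x| < d -> 0 <= t <= 1 ->
  `|b + t *: (a - b) - x| < d.
Proof.
move=> ad bd /andP[t0 t1].
rewrite (_ : _ - x = t *: (a - x) + (1 - t) *: (b - x)); last first.
  by rewrite scalerBl scale1r addrCA -scalerBr opprB addrA subrK addrAC.
rewrite (le_lt_trans (ler_normD _ _)) // !normrZ ger0_norm //.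
rewrite ger0_norm ?subr_ge0 //.
have [->|tn0] := eqVneq t 0; first by rewrite mul0r add0r subr0 mul1r.
have t0' : 0 < t by rewrite lt_neqAle eq_sym tn0.
by nra.
Qed.

Lemma lip_near_point f x K : lip_near x K f ->
  \forall z \near x, `|f z - f x| <= K * `|z - x|.
Proof.
move=> /near_diag[d d0 fK]; move: (near_norm x d0); apply: filterS => z zx.
by apply: (fK z x) => //; rewrite subrr normr0.
Qed.

End StrictDifferentiability.

(** * Equivalence of strict differentiability and C^1 smoothness *)

Definition op_continuous (R : realType) (V W : normedModType R) (A : V -> W -> R) :=
  forall x (e : R), 0 < e -> \forall y \near x, forall v, `|A y v - A x v| <= e * `|v|.

Section C1StrictDifferentiability.
Context {R : realType} {V : normedModType R}.
Implicit Types (f g L : V -> R) (x y : V) (K e : R).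

Lemma bounded_linear_diff f x : differentiable f x -> bounded_linear ('d f x).
Proof.
move=> fx; split=> [a u v|]; first by rewrite linearP.
have cf : continuous ('d f x) by exact: diff_continuous.
have /linear_boundedP/pinfty_ex_gt0[K K0 fK] := continuous_linear_bounded 0 (cf 0).
by exists K.
Qed.

Lemma frechet f x e : differentiable f x -> 0 < e ->
  \forall z \near x, `|f z - f x - 'd f x (z - x)| <= e * `|z - x|.
Proof.
move=> /diff_locally/eqaddoP fo /fo {fo}; rewrite [\forall h \near _, _ <= _](near_shift x) sub0r.
apply: filterS => z /=; rewrite !fctE /= subrK.
by rewrite opprD addrA.
Qed.

Lemma dual_norm_ge L v : bounded_linear L -> `|L v| <= dual_norm L * `|v|.
Proof.
move=> bL; have [K K0 LK] := bL.2.
have [->|v0] := eqVneq v 0; first by rewrite (lin0 bL) !normr0 mulr0.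
have nv0 : 0 < `|v| by rewrite normr_gt0.
have -> : L v = `|v| * L (`|v|^-1 *: v) by rewrite linZ // mulrA divff ?mul1r // gt_eqF.
rewrite normrM normr_id mulrC ler_wpM2r //; apply: sup_ubound => /=.
  exists K => _ [w /= w1 <-]; rewrite (le_trans (LK w)) //.
  by rewrite -[leRHS]mulr1 ler_wpM2l // ltW.
by exists (`|v|^-1 *: v) => //=; rewrite normrZ normfV normr_id mulVf // gt_eqF.
Qed.

Lemma dual_norm_le L c : (forall v, `|L v| <= c * `|v|) -> 0 <= c -> `|dual_norm L| <= c.
Proof.
move=> Lc c0; have hL : [set `|L v| | v in [set v : V | `|v| <= 1]] !=set0.
  by exists `|L 0|, 0 => //=; rewrite normr0.
have ub : ubound [set `|L v| | v in [set v : V | `|v| <= 1]] c.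
  move=> _ [v /= v1 <-]; rewrite (le_trans (Lc v)) //.
  by rewrite -[leRHS]mulr1 ler_wpM2l.
rewrite ger0_norm; first exact: ge_sup.
apply: (@le_trans _ _ `|L 0|) => //; apply: sup_ubound; first by exists c.
by exists 0 => //=; rewrite normr0.
Qed.

(** The mean value inequality is applied to [f \- 'd f x] on a ball where the derivative stays
    within [e / 2] of its value at [x]. *)
Lemma C1_on_sdiff (U : set V) f x : open U -> C1_on U f -> U x ->
  sdiff f x ('d f x).
Proof.
move=> oU [df cf] Ux; split=> [|e e0]; first exact: bounded_linear_diff (df x Ux).
have e2 : 0 < e / 2 by rewrite divr_gt0.
have := cf x Ux => /cvgrPdist_le /(_ _ e2); rewrite near_withinE => cfx.
have [d d0 dU] := norm_near (filterI (open_nbhs_nbhs (conj oU Ux)) cfx).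
move: (near_both (near_norm x d0)); apply: filterS => -[a b] /= [ad bd].
apply: (@local_lip_segment _ _ (f \- 'd f x)) => t /andP[t0 t1]; set p := b + _.
have pd : `|p - x| < d.
  by apply: segment_ball => //; rewrite t0.
have [Up /(_ Up)] := dU p pd; rewrite sub0r normrN => dn.
have {}dn v : `|'d f p v - 'd f x v| <= e / 2 * `|v|.
  have bl := bounded_linearB (bounded_linear_diff (df p Up))
    (bounded_linear_diff (df x Ux)).
  rewrite (le_trans (dual_norm_ge v bl)) // ler_wpM2r //.
  exact: le_trans (ler_norm _) dn.
move: (frechet (df p Up) e2); apply: filterS => z fz.
rewrite (_ : _ - _ - (_ - _) = (f z - f p - 'd f p (z - p)) +
  ('d f p (z - p) - 'd f x (z - p))); last first.
  by rewrite /= (linB z p (bounded_linear_diff (df x Ux))); ring.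
by rewrite (le_trans (ler_normD _ _)) // (splitr e) mulrDl lerD.
Qed.

Lemma sdiff_is_diff f x L : sdiff f x L ->
  differentiable f x /\ 'd f x = L :> (V -> R).
Proof.
move=> [bL fL].
have lL : linear (L : V -> R^o) by move=> a u v; rewrite bL.1.
pose Ll : {linear V -> R} := HB.pack (L : V -> R) (GRing.isLinear.Build _ _ _ _ _ lL).
have cL : continuous Ll.
  apply: bounded_linear_continuous; apply/linear_boundedP.
  have [K K0 LK] := bL.2; near=> r => v; rewrite (le_trans (LK v)) //.
  by rewrite ler_wpM2r.
have fo : f \o shift x = cst (f x) + Ll +o_ 0 id.
  apply/eqaddoP => e e0; rewrite [\forall h \near _, _ <= _](near_shift x) sub0r.
  have := lip_near_point (fL _ e0); apply: filterS => z /=; rewrite !fctE /= subrK.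
  by rewrite (linB z x bL); congr (`|_| <= _); ring.
have dL := diff_unique cL fo; split => //.
apply/diff_locallyP; split; rewrite dL //.
Unshelve. all: by end_near. Qed.

(** The bound [e] on the Lipschitz constant of [f \- D x] in a ball around [x] also holds near every
    [y] of that ball, where it bounds the derivative [D y \- D x]. *)
Lemma sdiff_op_continuous f (D : V -> V -> R) :
  (forall x, sdiff f x (D x)) -> op_continuous D.
Proof.
move=> fD x e e0; have [bD /(_ e e0)/near_diag[d d0 fd]] := fD x.
move: (near_norm x d0); apply: filterS => y yd v.
have := sdiff_le (sdiffB (fD y) (sdiff_lin y bD)); apply.
have dy : 0 < d - `|y - x| by rewrite subr_gt0.
move: (near_both (near_norm y dy)); apply: filterS => -[a b] /= [ay by_].
apply: (fd a b); rewrite -(subrKA y) (le_lt_trans (ler_normD _ _)) //.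
- by rewrite -ltrBrDr.
- by rewrite -ltrBrDr.
Qed.

Lemma smooth_C1 f : smooth f -> C1 f.
Proof.
move=> sf; have df x : sdiff f x ('d f x) /\ differentiable f x.
  by have [L fL] := sf x; have [? dL] := sdiff_is_diff fL; rewrite dL.
split=> [x _|x _]; first exact: (df x).2.
apply/cvgrPdist_le => e e0; rewrite near_withinE.
move: (sdiff_op_continuous (fun x => (df x).1) x e0).
apply: filterS => y yd _; rewrite sub0r normrN.
by apply: dual_norm_le => //; exact: ltW.
Qed.

End C1StrictDifferentiability.

(** * A C^1 positive part and a C^1 minimum of two numbers *)

Section SmoothPositivePart.
Context {R : realType}.
Implicit Types (a b t d : R).

Let pos1 t : R := if t <= -1 then 0 else if 1 <= t then t else (t + 1) ^+ 2 / 4.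

Let dpos1 t : R := if t <= -1 then 0 else if 1 <= t then 1 else (t + 1) / 2.

(** The subgradient inequality, [dpos1] being the derivative of [pos1]. Used in both directions it
    traps the difference quotient between two values of [dpos1]; monotonicity and strict
    differentiability both follow from this. *)
Let pos1_convex a b : dpos1 b * (a - b) <= pos1 a - pos1 b.
Proof.
rewrite /pos1 /dpos1.
have := sqr_ge0 (a - b); have := sqr_ge0 (a - 1); have := sqr_ge0 (b - 1).
have := sqr_ge0 (a + 1); have := sqr_ge0 (b + 1).
case: (lerP a (-1)) => ?; case: (lerP 1 a) => ?;
  case: (lerP b (-1)) => ?; case: (lerP 1 b) => ?; nra.
Qed.

Let dpos1_lip a b : `|dpos1 a - dpos1 b| <= `|a - b|.
Proof.
wlog ab : a b / a <= b.
  by move=> h; case/orP: (le_total a b) => /h //; rewrite distrC (distrC a).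
rewrite (ler0_norm (_ : a - b <= 0)); last by rewrite subr_le0.
rewrite ler_norml /dpos1.
by apply/andP; split;
  case: (lerP a (-1)) => ?; case: (lerP 1 a) => ?;
  case: (lerP b (-1)) => ?; case: (lerP 1 b) => ?; lra.
Qed.

Let dpos1_01 t : 0 <= dpos1 t <= 1.
Proof. by rewrite /dpos1; apply/andP; split;
  case: (lerP t (-1)) => ?; case: (lerP 1 t) => ?; lra. Qed.

(* A C^1 approximation of the positive part, equal to it outside [-d, d]. *)
Definition smooth_pos d t : R := d * pos1 (t / d).

Lemma smooth_pos0 d t : 0 < d -> t <= - d -> smooth_pos d t = 0.
Proof.
move=> d0 td; rewrite /smooth_pos /pos1 ifT ?mulr0 //.
by rewrite ler_pdivrMr // mulN1r.
Qed.

Lemma smooth_pos_ge d t : 0 < d -> t <= smooth_pos d t.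
Proof.
move=> d0; rewrite /smooth_pos -ler_pdivrMl // mulrC /pos1.
by case: (lerP (t / d) (-1)) => ?; case: (lerP 1 (t / d)) => ?; nra.
Qed.

Lemma smooth_pos_ge0 d t : 0 < d -> 0 <= smooth_pos d t.
Proof.
move=> d0; rewrite /smooth_pos mulr_ge0 ?(ltW d0) // /pos1.
by case: (lerP (t / d) (-1)) => ?; case: (lerP 1 (t / d)) => ?; nra.
Qed.

Lemma smooth_pos_le0 d t : 0 < d -> t <= 0 -> smooth_pos d t <= d / 4.
Proof.
move=> d0 t0; rewrite /smooth_pos ler_wpM2l ?(ltW d0) //.
have : t / d <= 0 by rewrite ler_pdivrMr // mul0r.
by rewrite /pos1; case: (lerP (t / d) (-1)) => ?; case: (lerP 1 (t / d)) => ? ?; nra.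
Qed.

Lemma smooth_pos_leD d t : 0 < d -> 0 <= t -> smooth_pos d t <= t + d / 4.
Proof.
move=> d0 t0; rewrite /smooth_pos.
have -> : t + d / 4 = d * (t / d + 1 / 4) by field; rewrite gt_eqF.
rewrite ler_wpM2l ?(ltW d0) //.
have : 0 <= t / d by rewrite divr_ge0 // ltW.
by rewrite /pos1; case: (lerP (t / d) (-1)) => ?; case: (lerP 1 (t / d)) => ? ?; nra.
Qed.

Lemma smooth_pos_id d t : 0 < d -> d <= t -> smooth_pos d t = t.
Proof.
move=> d0 dt; rewrite /smooth_pos /pos1.
have dt1 : 1 <= t / d by rewrite ler_pdivlMr // mul1r.
by rewrite ifF ?dt1; [rewrite mulrC divfK // gt_eqF|apply/negbTE; rewrite -ltNge; lra].
Qed.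

Lemma smooth_pos_mono d a b : 0 < d -> b <= a ->
  0 <= smooth_pos d a - smooth_pos d b <= a - b.
Proof.
move=> d0 ba; rewrite /smooth_pos -mulrBr.
have {}ba : b / d <= a / d by rewrite ler_wpM2r // invr_ge0 ltW.
rewrite mulr_ge0 ?(ltW d0) //=; last first.
  by have := pos1_convex (a / d) (b / d); have := dpos1_01 (b / d); nra.
rewrite -ler_pdivlMl // mulrBr ![d^-1 * _]mulrC.
by have := pos1_convex (b / d) (a / d); have := dpos1_01 (a / d); nra.
Qed.

Lemma smooth_pos_lip d a b : 0 < d -> `|smooth_pos d a - smooth_pos d b| <= `|a - b|.
Proof.
move=> d0; wlog ba : a b / b <= a.
  by move=> h; case/orP: (le_total a b) => /h //; rewrite distrC (distrC a).
have /andP[h1 h2] := smooth_pos_mono d0 ba.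
by rewrite !ger0_norm // subr_ge0.
Qed.

Lemma smooth_pos_deriv d t e : 0 < d -> 0 < e -> \forall z \near (t, t),
  `|smooth_pos d z.1 - smooth_pos d z.2 - dpos1 (t / d) * (z.1 - z.2)|
     <= e * `|z.1 - z.2|.
Proof.
move=> d0 e0; have ed : 0 < e * d by rewrite mulr_gt0.
have nt : \forall s \near t, `|s - t| < e * d.
  by apply/nbhs_ballP; exists (e * d) => //= s; rewrite /ball /= distrC.
have : \forall z \near (t, t), `|z.1 - t| < e * d /\ `|z.2 - t| < e * d.
  by exists ([set s | `|s - t| < e * d], [set s | `|s - t| < e * d]) => // -[].
apply: filterS => -[a b] /= [ha hb].
have E s : s = d * (s / d) by rewrite mulrC divfK // gt_eqF.
rewrite [X in _ * (X - _)]E [X in _ * (_ - X)]E [X in e * `|X - _|]E.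
rewrite [X in e * `|_ - X|]E -!mulrBr mulrCA -mulrBr !normrM mulrCA.
rewrite ler_wpM2l //.
have {}ha : `|a / d - t / d| <= e.
  by rewrite -mulrBl normrM normfV (gtr0_norm d0) ler_pdivrMr // ltW.
have {}hb : `|b / d - t / d| <= e.
  by rewrite -mulrBl normrM normfV (gtr0_norm d0) ler_pdivrMr // ltW.
clear nt; move: (a / d) (b / d) (t / d) ha hb => {}a {}b {}t ha hb.
have {}ha := le_trans (dpos1_lip a t) ha.
have {}hb := le_trans (dpos1_lip b t) hb.
have h1 := pos1_convex a b; have h2 := pos1_convex b a.
have /ler_normlP[] := ha; have /ler_normlP[] := hb => *.
case/orP: (le_total a b) => ab.
  rewrite (ler0_norm (_ : a - b <= 0)); last by rewrite subr_le0.
  by rewrite ler_norml; apply/andP; split; nra.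
rewrite (ger0_norm (_ : 0 <= a - b)); last by rewrite subr_ge0.
by rewrite ler_norml; apply/andP; split; nra.
Qed.

(** Smooths [min a b = a - (a - b)^+]. It equals [a] exactly as soon as [b] exceeds [a] by [d], so
    terms that are too large drop out of an iterated minimum. *)
Definition smooth_min d a b := a - smooth_pos d (a - b).

Lemma smooth_min_lel d a b : 0 < d -> smooth_min d a b <= a.
Proof. by move=> d0; rewrite /smooth_min gerBl smooth_pos_ge0. Qed.

Lemma smooth_min_ler d a b : 0 < d -> smooth_min d a b <= b.
Proof. by move=> d0; rewrite /smooth_min; have := smooth_pos_ge (a - b) d0; lra. Qed.

Lemma smooth_min_ge d a b t : 0 < d -> t <= a -> t <= b ->
  t - d / 4 <= smooth_min d a b.
Proof.
move=> d0 ta tb; rewrite /smooth_min; case: (lerP (a - b) 0) => ab.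
  by have := smooth_pos_le0 d0 ab; lra.
by have := smooth_pos_leD d0 (ltW ab); lra.
Qed.

Lemma smooth_min_id d a b : 0 < d -> a + d <= b -> smooth_min d a b = a.
Proof. by move=> d0 ab; rewrite /smooth_min smooth_pos0 ?subr0 //; lra. Qed.

(** As the slopes of [smooth_pos] lie in [0, 1], the increment is a convex combination of those of
    the two arguments: iterated minima lose nothing in the Lipschitz constant. *)
Lemma smooth_min_lip d a b a' b' K : 0 < d -> `|a - a'| <= K -> `|b - b'| <= K ->
  `|smooth_min d a b - smooth_min d a' b'| <= K.
Proof.
move=> d0 /ler_normlP[a1 a2] /ler_normlP[b1 b2]; rewrite /smooth_min.
rewrite ler_norml; have [uu|/ltW uu] := leP (a - b) (a' - b').
  by have /andP[] := smooth_pos_mono d0 uu => *; apply/andP; split; lra.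
by have /andP[] := smooth_pos_mono d0 uu => *; apply/andP; split; lra.
Qed.

End SmoothPositivePart.

(** * Iterated smooth minima *)

Section SequentialMin.
Context {R : realType} {V : normedModType R}.
Implicit Types (f g : V -> R) (d K t : R).

Lemma smooth_smooth_pos d f : 0 < d -> smooth f -> smooth (fun x => smooth_pos d (f x)).
Proof.
move=> d0 sf x; have [L fL] := sf x; eexists.
by apply: (sdiff_comp _ fL) => e e0; exact: smooth_pos_deriv.
Qed.

Lemma smooth_smooth_min d f g : 0 < d -> smooth f -> smooth g ->
  smooth (fun x => smooth_min d (f x) (g x)).
Proof.
by move=> d0 sf sg; apply: (smoothB sf (smooth_smooth_pos d0 (smoothB sf sg))).
Qed.

(** The smoothing width is halved at each step, so that the total error stays below [d] for every
    [n]. *)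
Fixpoint seq_min d (p : nat -> V -> R) n x : R :=
  if n is m.+1 then smooth_min (d / 2 ^+ n) (seq_min d p m x) (p n x) else p 0 x.

Variables (d : R) (p : nat -> V -> R).
Hypothesis d0 : 0 < d.

Let dn0 n : 0 < d / 2 ^+ n.
Proof. by rewrite divr_gt0 // exprn_gt0. Qed.

Let dnd n : d / 2 ^+ n <= d.
Proof. by rewrite ler_pdivrMr ?exprn_gt0 // ler_peMr ?(ltW d0) // exprn_ege1 // ler1n. Qed.

Lemma seq_min_le n j x : (j <= n)%N -> seq_min d p n x <= p j x.
Proof.
elim: n => [|n IH]; first by rewrite leqn0 => /eqP ->.
rewrite leq_eqVlt => /orP[/eqP ->|/IH]; first exact: smooth_min_ler.
by apply: le_trans; exact: smooth_min_lel.
Qed.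

Lemma seq_min_ge n t x : (forall j, (j <= n)%N -> t <= p j x) ->
  t - d <= seq_min d p n x.
Proof.
(* The induction needs the sharper bound, which leaves [d / 2 ^+ n] of the error budget unspent at
   stage [n]. *)
move=> tp; apply: (@le_trans _ _ (t - d * (1 - (2 ^+ n)^-1))).
  by rewrite lerD2l lerN2 ler_piMr ?(ltW d0) // gerBl invr_ge0 exprn_ge0.
elim: n tp => [|n IH] tp.
  by rewrite expr0 invr1 subrr mulr0 subr0; exact: tp.
have {}IH := IH (fun j jn => tp j (leqW jn)).
have t' : t - d * (1 - (2 ^+ n)^-1) <= p n.+1 x.
  apply: le_trans (tp _ (leqnn _)); rewrite gerBl mulr_ge0 ?(ltW d0) //.
  by rewrite subr_ge0 invf_le1 ?exprn_gt0 // exprn_ege1 // ler1n.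
apply: le_trans (smooth_min_ge (dn0 n.+1) IH t').
have := dn0 n.+1; rewrite exprS invfM; set u := (2 ^+ n)^-1; nra.
Qed.

Lemma seq_min_lip K n a b : (forall j, `|p j a - p j b| <= K) ->
  `|seq_min d p n a - seq_min d p n b| <= K.
Proof. by move=> pK; elim: n => [|n IH] //=; exact: smooth_min_lip. Qed.

Lemma smooth_seq_min n : (forall j, smooth (p j)) -> smooth (seq_min d p n).
Proof. by move=> sp; elim: n => [|n IH] //=; exact: smooth_smooth_min. Qed.

Lemma seq_min_stable n x : seq_min d p n x + d <= p n.+1 x ->
  seq_min d p n.+1 x = seq_min d p n x.
Proof.
by move=> h; rewrite /= smooth_min_id // (le_trans _ h) // lerD2l dnd.
Qed.

End SequentialMin.

(** * Smooth approximation of Lipschitz functions *)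

Section LipschitzApproximation.
Context {R : realType} {V : normedModType R}.
Implicit Types (F : V -> R) (a x y : V) (d e : R).

(* What is needed of an equivalent C^1 norm, scaled to dominate the norm of V. *)
Definition gauge (N : V -> R) (C : R) :=
  [/\ forall x, `|x| <= N x <= C * `|x|,
      forall x y, `|N x - N y| <= C * `|x - y| &
      forall x, x != 0 -> exists L, sdiff N x L].

Lemma admits_C1_norm_gauge : admits_C1_norm V -> exists N C, gauge N C /\ 0 < C.
Proof.
move=> [N [[Ntri Nhom _] [c [C [c0 C0 cC]]] C1N]].
exists (fun x => c^-1 * N x), (c^-1 * C); split; last by rewrite mulr_gt0 ?invr_gt0.
split=> [x|x y|x x0].
- by rewrite ler_pdivlMl // -mulrA ler_pM2l ?invr_gt0.
- rewrite -mulrBr normrM gtr0_norm ?invr_gt0 // -mulrA ler_pM2l ?invr_gt0 //.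
  have NB u v : N u - N v <= C * `|u - v|.
    rewrite lerBlDr (le_trans _ (lerD (proj2 (andP (cC (u - v)))) (lexx _))) //.
    by rewrite -{1}(subrK v u).
  by rewrite ler_norml NB lerNl opprB distrC NB.
- have oU : open (~` [set 0] : set V).
    apply: closed_openC; apply: accessible_closed_set1.
    by apply: hausdorff_accessible; exact: norm_hausdorff.
  have Nx := C1_on_sdiff oU C1N (x := x).
  by exists (fun v => c^-1 * 'd N x v); apply: sdiffZ; apply: Nx; exact/eqP.
Qed.

Variables (N : V -> R) (C : R).
Hypotheses (NC : gauge N C) (C0 : 0 < C).

Lemma gauge_ge x : `|x| <= N x.
Proof. by case: NC => /(_ x)/andP[]. Qed.

Lemma gauge_le x : N x <= C * `|x|.
Proof. by case: NC => /(_ x)/andP[]. Qed.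

Lemma gauge_lip x y : `|N x - N y| <= C * `|x - y|.
Proof. by case: NC. Qed.

Lemma gauge_near a d : 0 < d -> \forall x \near a, N (x - a) < d.
Proof.
move=> d0; have dC : 0 < d / C by rewrite divr_gt0.
move: (near_norm a dC); apply: filterS => x; rewrite ltr_pdivlMr // => xa.
by rewrite (le_lt_trans (gauge_le _)) // mulrC.
Qed.

(** The shift by [2 * d] makes it vanish where [N (x - a) <= d], which hides the point at which a
    norm is not differentiable. *)
Definition smooth_dist d a x := smooth_pos d (N (x - a) - 2 * d).

Lemma smooth_dist_smooth d a : 0 < d -> smooth (smooth_dist d a).
Proof.
move=> d0 x; have [->|xa] := eqVneq x a.
  exists (fun _ => 0); apply: sdiff_eq (sdiff_cst 0 a).
  move: (gauge_near a d0); apply: filterS => z za.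
  by rewrite /smooth_dist smooth_pos0 //; lra.
have [_ _ /(_ (x - a))] := NC; rewrite subr_eq0 => /(_ xa)[L NL].
have tNL : sdiff (fun z => N (z - a)) x L.
  have E p q : (p - a) - (q - a) = p - q by rewrite opprB addrA subrK.
  have [bL NLe] := NL; split => // e /NLe.
  move=> /near_diag[r r0 rN].
  move: (near_both (near_norm x r0)); apply: filterS => -[u v] /= [ux vx].
  have := rN (u - a) (v - a); rewrite /= !E => /(_ ux vx).
  by rewrite !(linB _ a bL); congr (`|_| <= _); ring.
have cL := sdiff_cst (2 * d) x.
eexists; apply: (sdiff_comp _ (sdiffB tNL cL)) => e e0; exact: smooth_pos_deriv.
Qed.

Lemma smooth_dist_lip d a x y : 0 < d ->
  `|smooth_dist d a x - smooth_dist d a y| <= C * `|x - y|.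
Proof.
move=> d0; rewrite (le_trans (smooth_pos_lip _ _ d0)) //.
have := gauge_lip (x - a) (y - a); rewrite opprB !addrA subrK.
by congr (_ <= _); congr (`|_|); ring.
Qed.

Lemma smooth_dist_ge d a x : 0 < d -> N (x - a) - 2 * d <= smooth_dist d a x.
Proof. exact: smooth_pos_ge. Qed.

Lemma smooth_dist_le d a x : 0 < d -> smooth_dist d a x <= N (x - a).
Proof.
move=> d0; have N0 := le_trans (normr_ge0 _) (gauge_ge (x - a)).
have : - (2 * d) <= N (x - a) - 2 * d by lra.
move=> /(smooth_pos_mono d0)/andP[_].
by rewrite (smooth_pos0 d0 (t := - (2 * d))) ?/smooth_dist; lra.
Qed.

Lemma smooth_dist0 d a x : 0 < d -> N (x - a) <= d -> smooth_dist d a x = 0.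
Proof. by move=> d0 xa; rewrite /smooth_dist smooth_pos0 //; lra. Qed.

Variable xs : nat -> V.
Hypothesis xs_dense : forall x e, 0 < e -> exists n, `|x - xs n| < e.

Lemma gauge_dense x e : 0 < e -> exists n, N (x - xs n) < e.
Proof.
move=> e0; have eC : 0 < e / C by rewrite divr_gt0.
have [n] := xs_dense x eC; rewrite ltr_pdivlMr // => xn; exists n.
by rewrite (le_lt_trans (gauge_le _)) // mulrC.
Qed.

(* G is a sequential smooth minimum of F (xs n) + (distance to xs n); the
   penalty, which is large near xs 0, ..., xs (n-1), makes the n-th term
   inactive there, so that locally finitely many terms matter. *)
Lemma nonexpansive_smooth_approx F e : 0 < e ->
  (forall a b, `|F a - F b| <= `|a - b|) ->
  exists G, [/\ smooth G, forall x, `|G x - F x| <= e &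
                forall a b, `|G a - G b| <= 5 * C * `|a - b|].
Proof.
(* The final bounds are [F x - 3 * d] from below and [F x + 20 * d] from above. *)
move=> e0 F1; pose d := e / 20; have d0 : 0 < d by rewrite divr_gt0.
(* The iterated minimum of [q] up to [n] is a smoothed distance to [xs 0], ..., [xs (n - 1)]; the
   value [100 * d] stands for the distance to the empty set and only has to be at least [8 * d]. *)
pose q n x := if n is m.+1 then smooth_dist d (xs m) x else 100 * d.
(* The penalty is at least [24 * d] within [d] of an earlier point, and 0 where the smoothed
   distance to the earlier points is at least [7 * d]. It contributes 4 of the factor 5 in the
   Lipschitz constant. *)
pose p n x := F (xs n) + smooth_dist d (xs n) x +
  4 * smooth_pos d (6 * d - seq_min d q n x).
pose m := seq_min d p.
have sq n : smooth (q n).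
  by case: n => [|n]; [exact: smooth_cst|exact: smooth_dist_smooth].
have sm n : smooth (m n).
  apply: (@smooth_seq_min _ _ _ p d0 n) => j; apply: smoothD.
    by apply: smoothD; [exact: smooth_cst|exact: smooth_dist_smooth].
  apply: smoothZ; apply: smooth_smooth_pos => //; apply: smoothB.
    exact: smooth_cst.
  exact: smooth_seq_min.
have lq n a b : `|q n a - q n b| <= C * `|a - b|.
  case: n => [|n]; last exact: smooth_dist_lip.
  by rewrite /= subrr normr0 mulr_ge0 // ltW.
have lp n a b : `|p n a - p n b| <= 5 * C * `|a - b|.
  have h1 := smooth_dist_lip (xs n) a b d0.
  have h2 := smooth_pos_lip (6 * d - seq_min d q n a) (6 * d - seq_min d q n b) d0.
  have h3 := @seq_min_lip _ _ _ _ d0 (C * `|a - b|) n a b (fun j => lq j a b).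
  have {}h2 := le_trans h2 (_ : _ <= C * `|a - b|).
  have {}h2 : `|smooth_pos d (6 * d - seq_min d q n a) -
    smooth_pos d (6 * d - seq_min d q n b)| <= C * `|a - b|.
    apply: h2; apply: le_trans h3; rewrite distrC.
    by rewrite (_ : _ - _ - (_ - _) = seq_min d q n a - seq_min d q n b) //; ring.
  rewrite /p (_ : _ - _ = (smooth_dist d (xs n) a - smooth_dist d (xs n) b) +
    4 * (smooth_pos d (6 * d - seq_min d q n a) -
         smooth_pos d (6 * d - seq_min d q n b))); last by ring.
  rewrite (le_trans (ler_normD _ _)) // normrM (gtr0_norm (_ : 0 < 4)) //; lra.
have lm n a b : `|m n a - m n b| <= 5 * C * `|a - b|.
  by apply: (@seq_min_lip _ _ _ p d0 _ n) => j; exact: lp.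
have FN n x : `|F x - F (xs n)| <= N (x - xs n).
  exact: le_trans (F1 _ _) (gauge_ge _).
have p_ge n x : F x - 2 * d <= p n x.
  rewrite /p; have := smooth_dist_ge (xs n) x d0.
  have := smooth_pos_ge0 (6 * d - seq_min d q n x) d0.
  by have /ler_normlP[_] := FN n x; lra.
have m_ge n x : F x - 3 * d <= m n x.
  have := @seq_min_ge _ _ _ p d0 n (F x - 2 * d) x (fun j _ => p_ge j x).
  by rewrite -/m; lra.
have p_large k n x : N (x - xs k) < d -> (k < n)%N -> F x + 22 * d <= p n x.
  move=> xk kn; have := seq_min_le q d0 x kn; rewrite /= smooth_dist0 ?(ltW xk) //.
  move=> D0; have := smooth_pos_ge (6 * d - seq_min d q n x) d0.
  rewrite /p; have := smooth_dist_ge (xs n) x d0.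
  by have /ler_normlP[_] := FN n x; lra.
have m_le k n x : N (x - xs k) < d -> (k <= n)%N -> m n x <= F x + 20 * d.
  move=> xk kn.
  (* The first [xs j] within [10 * d] of [x] has no penalty at [x], and its term is at most
     [F x + 20 * d]: [10 * d] for the distance, as much for the variation of [F]. *)
  have ex : exists k, N (x - xs k) < 10 * d by exists k; lra.
  case: (ex_minnP ex) => j xj jmin.
  have jn : (j <= n)%N by rewrite (leq_trans _ kn) // jmin //; lra.
  rewrite (le_trans (seq_min_le _ d0 _ jn)) // /p smooth_pos0 //.
    have := smooth_dist_le (xs j) x d0.
    by have /ler_normlP[] := FN j x; lra.
  have : 8 * d - d <= seq_min d q j x.
    apply: seq_min_ge => // -[_ /=|i ij /=]; first lra.
    apply: le_trans (smooth_dist_ge _ _ d0).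
    have : 10 * d <= N (x - xs i) by rewrite leNgt; apply/negP => /jmin; rewrite leqNgt ij.
    lra.
  lra.
(* Past [k], new terms are at least [F x + 22 * d], hence at least [d] above the current minimum,
   and leave it unchanged. *)
have m_stable k n x : N (x - xs k) < d -> (k <= n)%N -> m n x = m k x.
  move=> xk; elim: n => [|n IH]; first by rewrite leqn0 => /eqP ->.
  rewrite leq_eqVlt => /orP[/eqP -> //|kn]; rewrite -IH //.
  apply: seq_min_stable => //; have := m_le _ _ _ xk kn; rewrite -/m.
  by have := p_large k n.+1 x xk; rewrite ltnS => /(_ kn); lra.
have /choice[kappa kx] : forall x, exists k, N (x - xs k) < d.
  by move=> x; exact: gauge_dense.
have GE k x : N (x - xs k) < d -> m (kappa x) x = m k x.
  move=> xk; case/orP: (leq_total k (kappa x)) => h; first exact: m_stable.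
  by rewrite (m_stable _ _ _ (kx x) h).
exists (fun x => m (kappa x) x); split.
- move=> x; have [L mL] := sm (kappa x) x; exists L.
  apply: sdiff_eq mL.
  have : 0 < (d - N (x - xs (kappa x))) / C by rewrite divr_gt0 // subr_gt0.
  move=> /(near_norm x); apply: filterS => z; rewrite ltr_pdivlMr // => zx.
  rewrite (GE (kappa x)) //.
  have := gauge_lip (z - xs (kappa x)) (x - xs (kappa x)).
  rewrite opprB addrA subrK => /ler_normlP[_].
  by move: zx; rewrite mulrC; lra.
- move=> x; rewrite ler_norml; have := m_ge (kappa x) x.
  have := m_le _ _ _ (kx x) (leqnn _); have : e = 20 * d by rewrite /d; lra.
  by move=> *; apply/andP; split; lra.
- move=> a b; case/orP: (leq_total (kappa a) (kappa b)) => h.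
    by rewrite -(m_stable _ _ _ (kx a) h).
  by rewrite -(m_stable _ _ _ (kx b) h).
Qed.

End LipschitzApproximation.

(** * Smooth Lipschitz partitions of unity *)

Section PartitionOfUnity.
Context {R : realType} {V : normedModType R}.
Implicit Types (f g : V -> R) (a x y : V) (d e r : R).

Definition lipschitz_fun f := exists2 M, 0 <= M & forall a b, `|f a - f b| <= M * `|a - b|.

Lemma lipschitz_mul_unit f g : (forall x, 0 <= f x <= 1) -> (forall x, 0 <= g x <= 1) ->
  lipschitz_fun f -> lipschitz_fun g -> lipschitz_fun (f \* g).
Proof.
move=> f01 g01 [M M0 fM] [K K0 gK]; exists (M + K) => [|a b]; first exact: addr_ge0.
rewrite /= (_ : _ - _ = (f a - f b) * g a + f b * (g a - g b)); last by ring.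
have /andP[fb0 fb1] := f01 b; have /andP[ga0 ga1] := g01 a.
rewrite (le_trans (ler_normD _ _)) // !normrM mulrDl lerD //.
  by rewrite [`|g a|]ger0_norm // (le_trans _ (fM a b)) // ler_piMr.
by rewrite [`|f b|]ger0_norm // (le_trans _ (gK a b)) // ler_piMl.
Qed.

Variables (N : V -> R) (C : R).
Hypotheses (NC : gauge N C) (C0 : 0 < C).

(** The two nested positive parts smooth [1 - (1 - v^+)^+ = min 1 v^+]. Here [v] is affine in the
    smoothed distance to [a]: it is 5 where that distance is 0, and at most -1 where it is at least
    [2 * d]. *)
Lemma smooth_bump a d : 0 < d -> exists u : V -> R,
  [/\ smooth u, forall x, 0 <= u x <= 1, lipschitz_fun u,
      forall x, N (x - a) < d -> u x = 1 &
      forall x, u x != 0 -> `|x - a| < 4 * d].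
Proof.
move=> d0.
pose s := @smooth_pos R 1; pose v x := 5 - 3 / d * smooth_dist N d a x.
exists (fun x => 1 - s (1 - s (v x))).
have sge0 t : 0 <= s t by exact: smooth_pos_ge0.
split.
- apply: smoothB; first exact: smooth_cst.
  apply: smooth_smooth_pos => //; apply: smoothB; first exact: smooth_cst.
  apply: smooth_smooth_pos => //; apply: smoothB; first exact: smooth_cst.
  by apply: smoothZ; exact: (smooth_dist_smooth NC).
- move=> x; apply/andP; split; last by rewrite gerBl.
  have h : 1 - s (v x) <= 1 by rewrite gerBl.
  rewrite subr_ge0 (le_trans (y := s 1)) //; last first.
    by rewrite /s smooth_pos_id.
  by have /andP[] := smooth_pos_mono ltr01 h; rewrite subr_ge0.
- exists (3 / d * C) => [|x y]; first by rewrite mulr_ge0 ?divr_ge0 // ltW.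
  have E (k t t' : R) : `|(k - t) - (k - t')| = `|t - t'|.
    by rewrite distrC; congr (`|_|); ring.
  rewrite E (le_trans (smooth_pos_lip _ _ ltr01)) //.
  rewrite E (le_trans (smooth_pos_lip _ _ ltr01)) //.
  rewrite E -mulrBr normrM ger0_norm; last first.
    by rewrite divr_ge0 // ltW.
  rewrite -(mulrA (3 / d)) ler_wpM2l ?divr_ge0 ?(ltW d0) //.
  exact: (smooth_dist_lip NC).
- move=> x xa; rewrite /v (smooth_dist0 d0 (ltW xa)) mulr0 subr0.
  by rewrite {2}/s smooth_pos_id ?ler1n // /s smooth_pos0 ?subr0 //; lra.
- move=> x; rewrite ltNge; apply: contra_neqN => xa.
  have h := smooth_dist_ge N a x d0; have := gauge_ge NC (x - a) => h'.
  have vx : v x <= -1.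
    rewrite /v lerBlDr -lerBlDl -ler_pdivrMl ?divr_gt0 // invf_div.
    by rewrite (_ : _ * _ = 2 * d); [lra|field].
  by rewrite {2}/s smooth_pos0 // subr0 /s smooth_pos_id // subrr.
Qed.

Variable xs : nat -> V.
Hypothesis xs_dense : forall x e, 0 < e -> exists n, `|x - xs n| < e.

(** Each pair of a dense point [xs n] and a scale [m] gets one centre in [U], close to [xs n] and of
    large radius for that scale, if there is any. Two points that qualify for the same pair are so
    close that the ball of either one contains the other. *)
Lemma lindelof (U : set V) (r : V -> R) : U !=set0 -> (forall x, U x -> 0 < r x) ->
  exists c : nat -> V, (forall i, U (c i)) /\
    forall x, U x -> exists i, N (x - c i) < r (c i).
Proof.
move=> [x0 Ux0] r0.
pose good (nm : nat * nat) x := [/\ U x, `|x - xs nm.1| < nm.2.+1%:R^-1 &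
  2 * C * nm.2.+1%:R^-1 < r x].
have /choice[c cP] : forall nm, exists c, U c /\ ((exists x, good nm x) -> good nm c).
  move=> nm; have [[x gx]|ng] := pselect (exists x, good nm x).
    by exists x; split => //; case: gx.
  by exists x0.
exists (fun n => c (odflt (0, 0)%N (unpickle n))); split=> [i|x Ux].
  exact: (cP _).1.
have e0 : 0 < r x / (2 * C) by rewrite divr_gt0 ?mulr_gt0 ?r0.
have [m mx] : exists m, m.+1%:R^-1 < r x / (2 * C).
  have [m _ /(_ m (leqnn _)) /=] := near_infty_natSinv_lt (PosNum e0).
  by exists m.
have m0 : 0 < m.+1%:R^-1 :> R by rewrite invr_gt0.
have [n xn] := xs_dense x m0.
have [Uc cn cr] : good (n, m) (c (n, m)).
  apply: (cP (n, m)).2.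
  by exists x; split => //=; move: mx; rewrite ltr_pdivlMr ?mulr_gt0 // mulrC.
exists (pickle (n, m)); rewrite pickleK /=.
rewrite (le_lt_trans (gauge_le NC _)) // (le_lt_trans _ cr) //.
rewrite [2 * C]mulrC -mulrA ler_wpM2l ?(ltW C0) //= mulr_natl mulr2n.
rewrite -(subrKA (xs n)) (le_trans (ler_normD _ _)) // lerD //; first exact: ltW.
by rewrite distrC ltW.
Qed.

(** With [phi n = u n * w n] and [w n] the product of the [1 - u i] for [i < n], the partial sums
    telescope to [1 - w n], which is 1 as soon as some earlier bump is 1. No division occurs, so
    each [phi n] is globally Lipschitz. *)
Lemma partition_of_unity (U : set V) (r : V -> R) :
  U !=set0 -> (forall x, U x -> 0 < r x) ->
  exists (c : nat -> V) (phi : nat -> V -> R),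
  [/\ forall i, U (c i), forall i, smooth (phi i) /\ lipschitz_fun (phi i),
      forall i x, 0 <= phi i x,
      forall i x, phi i x != 0 -> `|x - c i| < r (c i) / 2 &
      forall x, U x -> exists k, \forall z \near x,
        forall n, (k <= n)%N -> \sum_(i < n) phi i z = 1].
Proof.
(* A bump that is 1 on a ball of radius [r / 8] lives within 4 times that radius, which is the
   [r / 2] of the statement. *)
move=> U0 r0.
have r8 x : U x -> 0 < r x / 8 by move=> /r0 ?; rewrite divr_gt0.
have [c [cU cc]] := lindelof U0 r8.
have /choice[u uP] i := smooth_bump (c i) (r8 _ (cU i)).
pose w n x := \prod_(i < n) (1 - u i x).
have wS n : w n.+1 = w n \* (fun x => 1 - u n x).
  by apply/funext => x; rewrite /w big_ord_recr.
have u01 i x : 0 <= 1 - u i x <= 1.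
  by have [_ /(_ x) /andP[? ?] _ _ _] := uP i; apply/andP; split; lra.
have lu i : lipschitz_fun (fun x => 1 - u i x).
  have [_ _ [M M0 uM] _ _] := uP i; exists M => // a b.
  by rewrite distrC (_ : _ - _ - _ = u i a - u i b) //; ring.
have w01 n x : 0 <= w n x <= 1.
  apply/andP; split; first by apply: prodr_ge0 => i _; have /andP[] := u01 i x.
  by apply: prodr_ile1 => i _; exact: u01.
have sw n : smooth (w n).
  elim: n => [|n IH]; last first.
    rewrite wS; apply: smoothM IH (smoothB (smooth_cst _) _).
    by have [] := uP n.
  by rewrite (_ : w 0%N = fun=> 1); [exact: smooth_cst|apply/funext => x; rewrite /w big_ord0].
have lw n : lipschitz_fun (w n).
  elim: n => [|n IH]; last by rewrite wS; exact: lipschitz_mul_unit.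
  by exists 0 => // a b; rewrite /w !big_ord0 subrr normr0 mul0r.
exists c, (fun n => u n \* w n); split => //.
- move=> i; have [su u01' lu' _ _] := uP i; split; first exact: smoothM.
  exact: lipschitz_mul_unit.
- move=> i x; have [_ /(_ x)/andP[? _] _ _ _] := uP i.
  by rewrite mulr_ge0 //; have /andP[] := w01 i x.
- move=> i x; rewrite mulf_eq0 negb_or => /andP[ux _].
  by have [_ _ _ _ /(_ x ux)] := uP i; congr (_ < _); field.
- move=> x Ux; have [k xk] := cc x Ux; exists k.+1.
  have : 0 < (r (c k) / 8 - N (x - c k)) / C by rewrite divr_gt0 // subr_gt0.
  move=> /(near_norm x); apply: filterS => z; rewrite ltr_pdivlMr // => zx n kn.
  have zk : N (z - c k) < r (c k) / 8.
    have := gauge_lip NC (z - c k) (x - c k).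
    rewrite opprB addrA subrK => /ler_normlP[_].
    by move: zx; rewrite mulrC; lra.
  have -> : \sum_(i < n) u i z * w i z = 1 - w n z.
    elim: n {kn} => [|n IH]; first by rewrite big_ord0 /w big_ord0 subrr.
    by rewrite big_ord_recr /= IH wS /=; ring.
  rewrite /w (bigD1 (Ordinal kn)) //=.
  by have [_ _ _ /(_ _ zk) -> _] := uP k; rewrite subrr mul0r subr0.
Qed.

End PartitionOfUnity.

(** * Bounds for infima and suprema of families *)

Section InfSup.
Context {R : realType} {I : Type}.
Implicit Types (D : set I) (f : I -> R) (m : R).

Lemma inf_on_le D f m i : (forall j, D j -> m <= f j) -> D i -> inf (f @` D) <= f i.
Proof.
move=> mf Di; apply: ge_inf; last by exists i.
by exists m => _ [j Dj <-]; exact: mf.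
Qed.

Lemma inf_on_ge D f m : D !=set0 -> (forall j, D j -> m <= f j) -> m <= inf (f @` D).
Proof.
move=> [i Di] mf; apply: lb_le_inf; first by exists (f i), i.
by move=> _ [j Dj <-]; exact: mf.
Qed.

Lemma sup_on_ge D f m i : (forall j, D j -> f j <= m) -> D i -> f i <= sup (f @` D).
Proof.
move=> mf Di; apply: sup_ubound; last by exists i.
by exists m => _ [j Dj <-]; exact: mf.
Qed.

Lemma sup_on_le D f m : D !=set0 -> (forall j, D j -> f j <= m) -> sup (f @` D) <= m.
Proof.
move=> [i Di] mf; apply: ge_sup; first by exists (f i), i.
by move=> _ [j Dj <-]; exact: mf.
Qed.

End InfSup.

(** * Minimal sublinear functionals *)

Section HahnBanach.
Context {R : realType} {V : lmodType R}.
Implicit Types (p q : V -> R) (x y : V) (a t : R).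

Definition sublinear p :=
  (forall x y, p (x + y) <= p x + p y) /\ (forall a x, 0 < a -> p (a *: x) <= a * p x).

Lemma sublinear0 p : sublinear p -> p 0 = 0.
Proof.
move=> [pD pZ]; apply/eqP; rewrite eq_le; apply/andP; split.
  have h : 0 < 2^-1 :> R by rewrite invr_gt0.
  by have := pZ _ 0 h; rewrite scaler0; lra.
by have := pD 0 0; rewrite addr0; lra.
Qed.

Lemma sublinear_ge p x : sublinear p -> - p (- x) <= p x.
Proof. by move=> sp; have := sp.1 x (- x); rewrite subrr (sublinear0 sp); lra. Qed.

Lemma sublinearZ p a x : sublinear p -> 0 < a -> p (a *: x) = a * p x.
Proof.
move=> sp a0; apply/eqP; rewrite eq_le sp.2 //=.
have := sp.2 a^-1 (a *: x); rewrite invr_gt0 scalerA mulVf ?gt_eqF // scale1r => /(_ a0).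
by rewrite ler_pdivlMl.
Qed.

(* A minimal sublinear functional q is linear: for every y, the sublinear
   functional x |-> inf_(t >= 0) q (x + t y) - t q y lies below q. *)
Lemma minimal_sublinear_linear q : sublinear q ->
  (forall r, sublinear r -> (forall x, r x <= q x) -> forall x, q x <= r x) ->
  forall a x y, q (a *: x + y) = a * q x + q y.
Proof.
move=> sq qmin.
have qD x y : q (x + y) = q x + q y.
  apply/eqP; rewrite eq_le sq.1 /= -lerBrDr.
  pose h z t := q (z + t *: y) - t * q y.
  pose r z := inf (h z @` [set t | 0 <= t]).
  have h_ge z t : 0 <= t -> - q (- z) <= h z t.
    rewrite le_eqVlt => /orP[/eqP <-|t0].
      by rewrite /h scale0r addr0 mul0r subr0 sublinear_ge.
    have := sq.1 (z + t *: y) (- z); rewrite addrAC subrr add0r sublinearZ // /h.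
    lra.
  have r_le z t : 0 <= t -> r z <= h z t by move=> t0; apply: (inf_on_le (h_ge z)).
  have r_ge z m : (forall t, 0 <= t -> m <= h z t) -> m <= r z.
    by move=> mh; apply: inf_on_ge mh; exists 0 => /=.
  have sr : sublinear r.
    split=> [z z'|a z a0].
      rewrite -lerBlDr; apply: (r_ge) => t t0 /=.
      rewrite lerBlDr -lerBlDl; apply: (r_ge) => t' t'0 /=.
      rewrite lerBlDr (le_trans (r_le _ _ (addr_ge0 t0 t'0))) // /h.
      have := sq.1 (z + t *: y) (z' + t' *: y).
      by rewrite addrACA -scalerDl; lra.
    rewrite -ler_pdivrMl //; apply: (r_ge) => t t0 /=.
    rewrite ler_pdivrMl // (le_trans (r_le _ _ (mulr_ge0 (ltW a0) t0))) // /h.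
    by rewrite -scalerA -scalerDr sublinearZ //; lra.
  have rq z : r z <= q z.
    by rewrite (le_trans (r_le z 0 _)) // /h scale0r addr0 mul0r subr0.
  rewrite (le_trans (qmin r sr rq x)) // (le_trans (r_le x 1 _)) //.
  by rewrite /h scale1r mul1r.
have qN x : q (- x) = - q x.
  by have := qD x (- x); rewrite subrr (sublinear0 sq); lra.
move=> a x y; rewrite qD; congr (_ + _).
case: (ltrgtP a 0) => [a0|a0|->].
- have := @sublinearZ q (- a) x sq; rewrite oppr_gt0 scaleNr qN => /(_ a0).
  by rewrite mulNr => /oppr_inj.
- by rewrite sublinearZ.
- by rewrite scale0r (sublinear0 sq) mul0r.
Qed.

(** Zorn's lemma: along a chain below [p] the pointwise infimum is finite, every member being at
    least [- p (- x)], and it is subadditive because the smaller of two members can serve both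
    summands. *)
Lemma exists_minimal_sublinear p : sublinear p ->
  exists q, [/\ sublinear q, forall x, q x <= p x &
    forall r, sublinear r -> (forall x, r x <= q x) -> forall x, q x <= r x].
Proof.
move=> sp; pose T := {q : V -> R | sublinear q /\ forall x, q x <= p x}.
(* The order is reversed: a maximal element is a minimal functional. *)
pose le (s t : T) := `[< forall x, sval t x <= sval s x >].
have tp : T by exists p.
have [||A Atot|q qmax] := @ZL_preorder T tp le.
- by move=> t; apply/asboolP.
- move=> r s t /asboolP rs /asboolP st; apply/asboolP => x.
  exact: le_trans (st x) (rs x).
- have [[s0 As0]|A0] := pselect (A !=set0); last first.
    by exists tp => s As; case: A0; exists s.
  pose q x := inf ((fun s : T => sval s x) @` A).
  have lb x (s : T) : A s -> - p (- x) <= sval s x.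
    move=> _; have [ss sle] := svalP s.
    by rewrite (le_trans _ (sublinear_ge x ss)) // lerN2.
  have q_le x (s : T) : A s -> q x <= sval s x.
    by move=> As; exact: (@inf_on_le R T A (fun s => sval s x) _ s (lb x)).
  have q_ge x m : (forall s, A s -> m <= sval s x) -> m <= q x.
    by move=> ms; apply: (@inf_on_ge R T A (fun s => sval s x)) ms; exists s0.
  have sq : sublinear q.
    split=> [x y|a x a0].
      rewrite -lerBlDr; apply: (q_ge) => s As /=.
      rewrite lerBlDr -lerBlDl; apply: (q_ge) => t At /=.
      rewrite lerBlDr; have [ss _] := svalP s; have [st _] := svalP t.
      have [/asboolP st'|/asboolP ts'] := Atot _ _ As At.
        rewrite (le_trans (q_le _ _ At)) // (le_trans (st.1 _ _)) // addrC lerD2l //.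
      by rewrite (le_trans (q_le _ _ As)) // (le_trans (ss.1 _ _)) // addrC lerD2r.
    rewrite -ler_pdivrMl //; apply: (q_ge) => s As /=.
    rewrite ler_pdivrMl // (le_trans (q_le _ _ As)) //.
    by have [ss _] := svalP s; rewrite sublinearZ.
  have qp x : q x <= p x.
    by rewrite (le_trans (q_le x _ As0)) //; have [_] := svalP s0.
  by exists (exist _ q (conj sq qp)) => s As; apply/asboolP => x; exact: q_le.
case: q qmax => q [sq qp] qmax; exists q; split => // r sr rq x.
have rp y : r y <= p y by exact: le_trans (rq y) (qp y).
have /asboolP /= := qmax (exist _ r (conj sr rp)) (asboolT rq).
exact.
Qed.

End HahnBanach.

(** * Norm-preserving extension of functionals *)

Section FunctionalExtension.
Context {R : realType} {V W : normedModType R}.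

(** The infimal convolution [p] of [A] with [K] times the norm is sublinear. A linear [q] below [p]
    is bounded by [K] times the norm (take [w = 0]) and satisfies [q (iota w) <= A w] (take
    [x = iota w]), hence equality by changing signs. *)
Lemma functional_extension (iota : W -> V) (A : W -> R) (K : R) :
  (forall a u v, iota (a *: u + v) = a *: iota u + iota v) ->
  (forall w, `|iota w| = `|w|) ->
  (forall a u v, A (a *: u + v) = a * A u + A v) ->
  0 < K -> (forall w, `|A w| <= K * `|w|) ->
  exists L : V -> R, [/\ bounded_linear L, forall v, `|L v| <= K * `|v| &
    forall w, L (iota w) = A w].
Proof.
move=> il im Al K0 AK.
pose h x w := A w + K * `|x - iota w|.
pose p x := inf (h x @` setT).
have h_ge x w : - (K * `|x|) <= h x w.
  have /ler_normlP[] := AK w; rewrite -im /h => hA _.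
  have := lerB_dist (iota w) x; rewrite distrC; nra.
have p_le x w : p x <= h x w by apply: (inf_on_le (fun w _ => h_ge x w)).
have p_ge x m : (forall w, m <= h x w) -> m <= p x.
  by move=> mh; apply: inf_on_ge => //; exists 0.
have i0 : iota 0 = 0 by have := im 0; rewrite normr0 => /eqP; rewrite normr_eq0 => /eqP.
have A0 : A 0 = 0 by have := AK 0; rewrite normr0 mulr0 normr_le0 => /eqP.
have AD u v : A (u + v) = A u + A v by have := Al 1 u v; rewrite scale1r mul1r.
have iD u v : iota (u + v) = iota u + iota v by have := il 1 u v; rewrite !scale1r.
have sp : sublinear p.
  split=> [x y|a x a0].
    rewrite -lerBlDr; apply: (p_ge) => w.
    rewrite lerBlDr -lerBlDl; apply: (p_ge) => w'.
    rewrite lerBlDr (le_trans (p_le _ (w + w'))) // /h.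
    rewrite AD iD opprD addrACA.
    have := ler_normD (x - iota w) (y - iota w'); nra.
  rewrite -ler_pdivrMl //; apply: (p_ge) => w.
  rewrite ler_pdivrMl // (le_trans (p_le _ (a *: w))) // /h.
  rewrite -[a *: w]addr0 Al il i0 A0 !addr0 -scalerBr normrZ gtr0_norm //; lra.
have [q [sq qp qmin]] := exists_minimal_sublinear sp.
have ql := minimal_sublinear_linear sq qmin.
have qN x : q (- x) = - q x.
  by have := ql (-1) x 0; rewrite scaleN1r !addr0 (sublinear0 sq) addr0 mulN1r.
have qK v : `|q v| <= K * `|v|.
  have h1 x : q x <= K * `|x|.
    by rewrite (le_trans (qp x)) // (le_trans (p_le x 0)) // /h i0 A0 subr0 add0r.
  by rewrite ler_norml h1 andbT lerNl -qN (le_trans (h1 _)) // normrN.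
have qA w : q (iota w) <= A w.
  by rewrite (le_trans (qp _)) // (le_trans (p_le _ w)) // /h subrr normr0 mulr0 addr0.
exists q; split => //; first by split => //; exists K.
move=> w; apply/eqP; rewrite eq_le qA /=.
have := qA (- w).
have -> : iota (- w) = - iota w.
  by have := il (-1) w 0; rewrite !scaleN1r !addr0 i0 addr0.
have -> : A (- w) = - A w.
  by have := Al (-1) w 0; rewrite !scaleN1r !addr0 A0 addr0 mulN1r.
by rewrite qN lerN2.
Qed.

End FunctionalExtension.

(** * Convex combinations and geometric bounds *)

Section WeightedSums.
Context {R : realType}.
Implicit Types (phi h : nat -> R) (a b n : nat) (c e : R).

(** Partial sums that remain equal to 1 force the later weights to be 0. *)
Lemma partition_sum_stable phi h a b :
  (forall n, (a <= n)%N -> \sum_(i < n) phi i = 1) ->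
  (forall n, (b <= n)%N -> \sum_(i < n) phi i = 1) ->
  \sum_(i < a) phi i * h i = \sum_(i < b) phi i * h i.
Proof.
wlog ab : a b / (a <= b)%N.
  by move=> H ha hb; case/orP: (leq_total a b) => /H ->.
move=> ha _; elim: b ab => [|b IH]; first by rewrite leqn0 => /eqP ->.
rewrite leq_eqVlt => /orP[/eqP -> //|]; rewrite ltnS => ab.
rewrite big_ord_recr /= -IH //.
have := ha _ (leqW ab); rewrite big_ord_recr /= ha // => h1.
by rewrite (_ : phi b = 0) ?mul0r ?addr0 //; lra.
Qed.

Lemma convex_sum_le phi h n c e : (forall i, 0 <= phi i) ->
  \sum_(i < n) phi i = 1 -> (forall i, phi i != 0 -> `|h i - c| <= e) ->
  `|\sum_(i < n) phi i * h i - c| <= e.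
Proof.
move=> phi0 phi1 he.
rewrite -[X in _ - X]mul1r -phi1 mulr_suml -sumrB.
rewrite (le_trans (ler_norm_sum _ _ _)) //.
rewrite -[leRHS]mul1r -phi1 mulr_suml; apply: ler_sum => i _.
have [->|pi0] := eqVneq (phi i) 0; first by rewrite !mul0r subrr normr0.
by rewrite -mulrBr normrM ger0_norm // ler_wpM2l // he.
Qed.

Lemma sum_half_pow n : \sum_(i < n) (2 ^+ i.+1)^-1 = 1 - (2 ^+ n)^-1 :> R.
Proof.
elim: n => [|n IH]; first by rewrite big_ord0 expr0 invr1 subrr.
by rewrite big_ord_recr /= IH exprS invfM; lra.
Qed.

Lemma half_pow_lt e : 0 < e -> exists n, (2 ^+ n)^-1 < e.
Proof.
move=> e0; have [n _ /(_ n (leqnn _)) /= ne] := near_infty_natSinv_lt (PosNum e0).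
exists n; apply: le_lt_trans ne.
by rewrite lef_pV2 ?posrE ?exprn_gt0 // -natrX ler_nat ltn_expl.
Qed.

Lemma half_pow_squeeze c e : 0 <= c -> (forall n, `|e| <= c * (2 ^+ n)^-1) -> e = 0.
Proof.
move=> c0 ec; apply/eqP; rewrite -normr_le0 leNgt; apply/negP => e0.
have c1 : 0 < c + 1 by lra.
have [n] := half_pow_lt (divr_gt0 e0 c1); rewrite ltr_pdivlMr //.
have : 0 < (2 ^+ n)^-1 :> R by rewrite invr_gt0 exprn_gt0.
by have := ec n; nra.
Qed.

End WeightedSums.

(** * Continuous lifting of a field of functionals (Bartle-Graves) *)

Section ContinuousExtension.
Context {R : realType} {V W : normedModType R}.
Implicit Types (w : W) (e K : R).

Variables (N : V -> R) (C : R).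
Hypotheses (NC : gauge N C) (C0 : 0 < C).
Variable xs : nat -> V.
Hypothesis xs_dense : forall x e, 0 < e -> exists n, `|x - xs n| < e.
Variable iota : W -> V.
Hypothesis iota_lin : forall a u v, iota (a *: u + v) = a *: iota u + iota v.
Hypothesis iota_norm : forall w, `|iota w| = `|w|.
Hypothesis iota_closed : closed (range iota).

Lemma iotaB u v : iota (u - v) = iota u - iota v.
Proof. by have := iota_lin (-1) v u; rewrite !scaleN1r addrC (addrC _ (iota u)). Qed.

Lemma iota_near w (P : V -> Prop) :
  (\forall x \near iota w, P x) -> \forall w' \near w, P (iota w').
Proof.
move=> /norm_near[d d0 dP]; move: (near_norm w d0); apply: filterS => w' ww'.
by apply: dP; rewrite -iotaB iota_norm.
Qed.

(** The extensions [E w] may depend wildly on [w]; locally, finitely many fixed ones averaged with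
    Lipschitz weights depend continuously on it. Convexity preserves common bounds, and the
    restriction is off by at most [e] because only points where [A] varies by at most [e] are
    averaged. *)
Lemma average_extensions (A : W -> W -> R) (E : W -> V -> R) e : 0 < e ->
  op_continuous A -> (forall w, bounded_linear (E w)) ->
  (forall w v, E w (iota v) = A w v) ->
  exists S : W -> V -> R,
    [/\ forall w, bounded_linear (S w), op_continuous S,
        forall w v, `|S w (iota v) - A w v| <= e * `|v| &
        forall v K, (forall w, `|E w v| <= K) -> forall w, `|S w v| <= K].
Proof.
move=> e0 cA bE EA.
have /choice[r rP] : forall x, exists r, 0 < r /\ forall w w',
    `|iota w - x| < r -> `|iota w' - x| < r ->
    forall v, `|A w v - A w' v| <= e * `|v|.
  move=> x; have [[w _ <-]|nx] := pselect (range iota x).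
    have e2 : 0 < e / 2 by rewrite divr_gt0.
    have [d d0 dA] := norm_near (cA w _ e2).
    exists d; split => // w1 w2; rewrite -!iotaB !iota_norm => /dA h1 /dA h2 v.
    rewrite (_ : _ - _ = (A w1 v - A w v) - (A w2 v - A w v)); last by ring.
    by rewrite (le_trans (ler_normB _ _)) // (splitr e) mulrDl lerD.
  have : nbhs x (~` range iota).
    by apply: open_nbhs_nbhs; split => //; exact: closed_openC.
  move=> /norm_near[d d0 dn]; exists d; split => // w w' /dn; case.
  by exists w.
have T0 : [set: V] !=set0 by exists 0.
have [c [phi [_ sphi phi0 phi_supp phi_sum]]] :=
  partition_of_unity NC C0 xs_dense T0 (fun x _ => (rP x).1).
have /choice[k kP] : forall x : V, exists k, \forall z \near x,
  forall n, (k <= n)%N -> \sum_(i < n) phi i z = 1 by move=> x; exact: phi_sum.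
(* The centre of a ball need not be in the range of [iota]; a point of the range in the ball, if
   any, replaces it. *)
have /choice[w0 w0P] : forall x, exists w0, forall w,
    `|iota w - x| < r x -> `|iota w0 - x| < r x.
  move=> x; have [[w wx]|nw] := pselect (exists w, `|iota w - x| < r x).
    by exists w.
  by exists 0 => w wx; case: nw; exists w.
pose H i := E (w0 (c i)).
pose S w v := \sum_(i < k (iota w)) phi i (iota w) * H i v.
have S1 w : \sum_(i < k (iota w)) phi i (iota w) = 1.
  exact: (nbhs_singleton (kP (iota w))).
exists S; split.
- move=> w; split.
    move=> a u v; rewrite /S mulr_sumr -big_split /=; apply: eq_bigr => i _.
    by rewrite /H (bE _).1; ring.
  have /choice[K KP] : forall i, exists K, 0 < K /\ forall v, `|H i v| <= K * `|v|.
    by move=> i; have [_ [K K0 HK]] := bE (w0 (c i)); exists K.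
  exists (\sum_(i < k (iota w)) phi i (iota w) * K i + 1) => [|v].
    by rewrite ltr_wpDl // sumr_ge0 // => i _; rewrite mulr_ge0 // ltW ?(KP i).1.
  rewrite mulrDl ler_wpDr ?mul1r // mulr_suml (le_trans (ler_norm_sum _ _ _)) //.
  apply: ler_sum => i _; rewrite normrM ger0_norm // -mulrA ler_wpM2l //.
  exact: (KP i).2.
- move=> w e' e'0; set n := k (iota w).
  have /choice[B BP] : forall i, exists B, 0 <= B /\ forall z z' v,
      `|(phi i z - phi i z') * H i v| <= B * `|z - z'| * `|v|.
    move=> i; have [_ [M M0 phiM]] := sphi i; have [_ [K K0 HK]] := bE (w0 (c i)).
    exists (M * K); split=> [|z z' v]; first by rewrite mulr_ge0 // ltW.
    rewrite normrM (mulrAC M) -[leRHS]mulrA; apply: ler_pM => //; exact: HK.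
  pose b := \sum_(i < n) B i.
  have b0 : 0 <= b by apply: sumr_ge0 => i _; exact: (BP i).1.
  have eb : 0 < e' / (b + 1) by rewrite divr_gt0 //; lra.
  move: (iota_near (kP (iota w))) (near_norm w eb).
  apply: filterS2 => w' kw'; rewrite ltr_pdivlMr; last lra.
  move=> ww' v.
  have -> : S w' v = \sum_(i < n) phi i (iota w') * H i v.
    apply: (@partition_sum_stable R (fun i => phi i (iota w')) (fun i => H i v)) => //.
    exact: (nbhs_singleton (kP (iota w'))).
  rewrite -sumrB (le_trans (ler_norm_sum _ _ _)) //.
  apply: (@le_trans _ _ (\sum_(i < n) B i * `|w' - w| * `|v|)).
    apply: ler_sum => i _; rewrite -mulrBl -iota_norm iotaB; exact: (BP i).2.
  rewrite -!mulr_suml ler_wpM2r // -/b (le_trans _ (ltW ww')) // mulrC.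
  by rewrite ler_wpM2l //; lra.
- move=> w v.
  apply: (@convex_sum_le R (fun i => phi i (iota w)) (fun i => H i (iota v))).
  + by move=> i; exact: phi0.
  + exact: S1.
  + move=> i /phi_supp wi; rewrite /H EA.
    have wi' : `|iota w - c i| < r (c i).
      by have := (rP (c i)).1; move: wi; lra.
    by apply: (rP (c i)).2 => //; exact: w0P wi'.
- move=> v K EK w; rewrite -[S w v]subr0.
  apply: (@convex_sum_le R (fun i => phi i (iota w)) (fun i => H i v)).
  + by move=> i; exact: phi0.
  + exact: S1.
  + by move=> i _; rewrite subr0; exact: EK.
Qed.

Let approx (A : W -> W -> R) n (P : W -> V -> R) :=
  [/\ forall w, bounded_linear (P w), op_continuous P &
      forall w v, `|P w (iota v) - A w v| <= (2 ^+ n)^-1 * `|v|].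

Let pow0 n : 0 < (2 ^+ n)^-1 :> R.
Proof. by rewrite invr_gt0 exprn_gt0. Qed.

Let bounded_linear_iota (L : V -> R) : bounded_linear L -> bounded_linear (L \o iota).
Proof.
move=> bL; split=> [a u v|]; first by rewrite /= iota_lin bL.1.
by have [K K0 LK] := bL.2; exists K => // v; rewrite /= -[`|v|]iota_norm.
Qed.

(** The restriction error [D] of [P] has norm at most [(2 ^+ n)^-1]. Its extensions of the same norm
    are averaged and added to [P]: the correction keeps that norm, while the new error is only the
    averaging error. *)
Let refine (A : W -> W -> R) n P : (forall w, bounded_linear (A w)) ->
  op_continuous A -> approx A n P -> exists P', approx A n.+1 P' /\
    forall w v, `|P' w v - P w v| <= (2 ^+ n)^-1 * `|v|.
Proof.
move=> bA cA [bP cP PA].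
pose D w v := A w v - P w (iota v).
have DK w v : `|D w v| <= (2 ^+ n)^-1 * `|v| by rewrite distrC.
have bD w : bounded_linear (D w) := bounded_linearB (bA w) (bounded_linear_iota (bP w)).
have cD : op_continuous D.
  move=> w e e0; have e2 : 0 < e / 2 by rewrite divr_gt0.
  move: (cA w _ e2) (cP w _ e2); apply: filterS2 => w' h1 h2 v.
  have := h2 (iota v); rewrite iota_norm => {}h2.
  rewrite /D (_ : _ - _ = (A w' v - A w v) - (P w' (iota v) - P w (iota v))); last by ring.
  by rewrite (le_trans (ler_normB _ _)) // (splitr e) mulrDl lerD.
have /choice[E EP] : forall w, exists L : V -> R, [/\ bounded_linear L,
    forall v, `|L v| <= (2 ^+ n)^-1 * `|v| & forall v, L (iota v) = D w v].
  by move=> w; apply: functional_extension (bD w).1 (pow0 n) (DK w).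
have [||S [bS cS SD SK]] := @average_extensions D E _ (pow0 n.+1) cD.
- by move=> w; have [] := EP w.
- by move=> w; have [] := EP w.
exists (fun w => P w \+ S w); split; last first.
  by move=> w v; rewrite /= addrAC subrr add0r; apply: SK => w'; have [] := EP w'.
split.
- by move=> w; exact: bounded_linearD.
- move=> w e e0; have e2 : 0 < e / 2 by rewrite divr_gt0.
  move: (cP w _ e2) (cS w _ e2); apply: filterS2 => w' h1 h2 v.
  rewrite /= (_ : _ - _ = (P w' v - P w v) + (S w' v - S w v)); last by ring.
  by rewrite (le_trans (ler_normD _ _)) // (splitr e) mulrDl lerD.
- move=> w v; have := SD w v; rewrite /D; congr (`|_| <= _); rewrite /=; ring.
Qed.

Lemma continuous_extension (A : W -> W -> R) : (forall w, bounded_linear (A w)) ->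
  op_continuous A -> exists T : W -> V -> R,
    [/\ forall w, bounded_linear (T w), op_continuous T &
        forall w v, T w (iota v) = A w v].
Proof.
move=> bA cA.
have [P0 P0P] : exists P, approx A 0 P.
  have /choice[E EP] : forall w, exists L : V -> R, bounded_linear L /\
      forall v, L (iota v) = A w v.
    move=> w; have [lA [K K0 AK]] := bA w.
    by have [L [bL _ LA]] := functional_extension iota_lin iota_norm lA K0 AK; exists L.
  have [||S [bS cS SA _]] := @average_extensions A E _ (pow0 0) cA.
  - by move=> w; have [] := EP w.
  - by move=> w; have [] := EP w.
  - by exists S.
(* The refinement is made total, with an arbitrary value off the approximations, so that it can be
   iterated. *)
have /choice[F FP] : forall nP : nat * (W -> V -> R), exists P', approx A nP.1 nP.2 ->
    approx A nP.1.+1 P' /\ forall w v, `|P' w v - nP.2 w v| <= (2 ^+ nP.1)^-1 * `|v|.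
  move=> [n P]; have [aP|naP] := pselect (approx A n P).
    by have [P' P'P] := refine bA cA aP; exists P'.
  by exists P.
pose P := fix P n := if n is m.+1 then F (m, P m) else P0.
have aP n : approx A n (P n) by elim: n => [|n IH] //; exact: (FP (n, P n) IH).1.
have PP n w v : `|P n.+1 w v - P n w v| <= (2 ^+ n)^-1 * `|v|.
  exact: (FP (n, P n) (aP n)).2.
(* Nested intervals around [P n w v]; the factor 2 is the sum of the remaining geometric steps. The
   supremum of the left ends is the limit, with an explicit rate that is uniform in [w]. *)
pose lo w v n := P n w v - 2 * (2 ^+ n)^-1 * `|v|.
pose hi w v n := P n w v + 2 * (2 ^+ n)^-1 * `|v|.
have powS n : (2 ^+ n.+1)^-1 = (2 ^+ n)^-1 / 2 :> R by rewrite exprS invfM mulrC.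
have lohi w v m n : lo w v m <= hi w v n.
  have loS j : lo w v j <= lo w v j.+1.
    have /ler_normlP[] := PP j w v; rewrite /lo powS; lra.
  have hiS j : hi w v j.+1 <= hi w v j.
    have /ler_normlP[] := PP j w v; rewrite /hi powS; lra.
  have lom : {homo lo w v : i j / (i <= j)%N >-> i <= j}.
    by apply: homo_leq => // y x z; exact: le_trans.
  have him : {homo hi w v : i j / (i <= j)%N >-> j <= i}.
    by apply: homo_leq => // y x z h1 h2; exact: le_trans h2 h1.
  apply: (le_trans (lom _ _ (leq_maxl m n))).
  apply: (le_trans _ (him _ _ (leq_maxr m n))).
  have := pow0 (maxn m n); have := normr_ge0 v; rewrite /lo /hi; nra.
pose T w v := sup (lo w v @` setT).
have nN : [set: nat] !=set0 by exists 0%N.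
have TP w v n : `|T w v - P n w v| <= 2 * (2 ^+ n)^-1 * `|v|.
  have h1 : lo w v n <= T w v.
    by apply: (@sup_on_ge _ _ _ _ (hi w v 0%N)) => // j _; exact: lohi.
  have h2 : T w v <= hi w v n by apply: sup_on_le => // j _; exact: lohi.
  by rewrite ler_norml; move: h1 h2; rewrite /lo /hi => *; apply/andP; split; lra.
have bT w : bounded_linear (T w).
  split=> [a u v|].
    apply/eqP; rewrite -subr_eq0; apply/eqP.
    apply: (@half_pow_squeeze _ (2 * (`|a *: u + v| + `|a| * `|u| + `|v|))).
      by rewrite mulr_ge0 // !addr_ge0 // mulr_ge0.
    move=> n; have [bP _ _] := aP n.
    have h1 := TP w (a *: u + v) n; have h2 := TP w u n; have h3 := TP w v n.
    rewrite (_ : _ - _ = (T w (a *: u + v) - P n w (a *: u + v))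
      - a * (T w u - P n w u) - (T w v - P n w v)); last by rewrite (bP w).1; ring.
    rewrite (le_trans (ler_normB _ _)) // (le_trans (lerD (ler_normB _ _) (lexx _))) //.
    rewrite normrM; have := normr_ge0 a; nra.
  have [bP _ _] := aP 0%N; have [_ [K K0 PK]] := bP w.
  exists (K + 2) => [|v]; first lra.
  have := TP w v 0%N; rewrite expr0 invr1 mulr1 => h1.
  rewrite -(subrK (P 0%N w v) (T w v)) (le_trans (ler_normD _ _)) //.
  by have := PK v; lra.
exists T; split => //.
- move=> w e e0; have e8 : 0 < e / 8 by rewrite divr_gt0.
  have [n ne] := half_pow_lt e8; have [_ cP _] := aP n.
  have e2 : 0 < e / 2 by rewrite divr_gt0.
  move: (cP w _ e2); apply: filterS => w' h v.
  have h1 := TP w' v n; have h2 := TP w v n; have {}h := h v.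
  rewrite (_ : _ - _ = (T w' v - P n w' v) - (T w v - P n w v) +
    (P n w' v - P n w v)); last by ring.
  rewrite (le_trans (ler_normD _ _)) // (le_trans (lerD (ler_normB _ _) (lexx _))) //.
  have := normr_ge0 v; nra.
- move=> w v; apply/eqP; rewrite -subr_eq0; apply/eqP.
  apply: (@half_pow_squeeze _ (3 * `|v|)); first by rewrite mulr_ge0.
  move=> n; have [_ _ PA] := aP n; have := TP w (iota v) n; rewrite iota_norm => h1.
  rewrite -(subrKA (P n w (iota v))) (le_trans (ler_normD _ _)) //.
  by have := PA w v; lra.
Qed.

End ContinuousExtension.

(** * Whitney-type extension, strictly differentiable on a set *)

Section WhitneyExtension.
Context {R : realType} {V : normedModType R}.
Implicit Types (x y z v : V) (e t s : R).
Variables (Z : set V) (f : V -> R) (T : V -> V -> R) (K : R).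
Hypothesis Z0 : Z !=set0.
Hypothesis K0 : 0 < K.
Hypothesis fK : forall y z, Z y -> Z z -> `|f z - f y| <= K * `|z - y|.
Hypothesis bT : forall y, Z y -> bounded_linear (T y).
Hypothesis TK : forall y, Z y -> forall v, `|T y v| <= K * `|v|.
Hypothesis jet : forall y0 e, Z y0 -> 0 < e -> exists2 d, 0 < d &
  forall y z, Z y -> Z z -> `|y - y0| < d -> `|z - y0| < d ->
    `|f z - f y - T y (z - y)| <= e * `|z - y| /\
    forall v, `|T y v - T y0 v| <= e * `|v|.

Let rho y z := `|f z - f y - T y (z - y)| / `|z - y|.

Let rhoE y z : Z y -> rho y z * `|z - y| = `|f z - f y - T y (z - y)|.
Proof.
move=> Zy; have [->|zy] := eqVneq z y.
  by rewrite !subrr (lin0 (bT Zy)) subr0 !normr0 mulr0.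
by rewrite divfK // normr_eq0 subr_eq0.
Qed.

Let rho_ge0 y z : 0 <= rho y z.
Proof. by rewrite divr_ge0. Qed.

Let rho_le y z e : Z y -> 0 <= e -> `|f z - f y - T y (z - y)| <= e * `|z - y| ->
  rho y z <= e.
Proof.
move=> Zy e0; have [->|zy] := eqVneq z y.
  by rewrite /rho !subrr (lin0 (bT Zy)) subr0 normr0 mul0r.
by move=> h; rewrite ler_pdivrMr // normr_gt0 subr_eq0.
Qed.

Let rho_leK y z : Z y -> Z z -> rho y z <= 2 * K.
Proof.
move=> Zy Zz; apply: rho_le => //; first by rewrite mulr_ge0 // ltW.
rewrite (le_trans (ler_normB _ _)) // -mulrA mulr_natl mulr2n lerD //.
  exact: fK.
exact: TK.
Qed.

(** At [t = |z - y|] this is the Taylor remainder at [z], so the supremum [P y] is a radial majorant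
    of the remainder. The factor 2 keeps slopes below [2 * rho y z] and lets only [z] within [2 * t]
    of [y] contribute, so that [P y] is flat near 0. *)
Let term y t z := rho y z * Num.max (2 * t - `|z - y|) 0.

Let P y t := sup (term y t @` Z).

Let term_le y t z : Z y -> 0 <= t -> Z z -> term y t z <= 2 * K * (2 * t).
Proof.
move=> Zy t0 Zz; apply: ler_pM => //; first by rewrite le_max lexx orbT.
  exact: rho_leK.
by rewrite ge_max; apply/andP; split; have := normr_ge0 (z - y); lra.
Qed.

Let P_ge y t z : Z y -> 0 <= t -> Z z -> term y t z <= P y t.
Proof. by move=> Zy t0; apply: sup_on_ge => z' Zz'; exact: term_le. Qed.

Let P_le y t m : (forall z, Z z -> term y t z <= m) -> P y t <= m.
Proof. exact: sup_on_le. Qed.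

Let P_0 y : Z y -> P y 0 = 0.
Proof.
move=> Zy; apply/eqP; rewrite eq_le; apply/andP; split.
  by apply: P_le => z Zz; rewrite (le_trans (term_le Zy _ Zz)) // !mulr0.
by rewrite (le_trans _ (P_ge Zy (lexx 0) Zy)) // mulr_ge0 // le_max lexx orbT.
Qed.

Let P_interp y z : Z y -> Z z -> `|f z - f y - T y (z - y)| <= P y `|z - y|.
Proof.
move=> Zy Zz; rewrite (le_trans _ (P_ge Zy (normr_ge0 _) Zz)) // -rhoE // /term.
by rewrite ler_wpM2l // le_max; apply/orP; left; lra.
Qed.

Let P_lip y s t e : Z y -> 0 <= t -> t <= s ->
  (forall z, Z z -> `|z - y| < 2 * s -> rho y z <= e) ->
  0 <= P y s - P y t <= 2 * e * (s - t).
Proof.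
move=> Zy t0 ts he; have s0 : 0 <= s by exact: le_trans ts.
rewrite subr_ge0; apply/andP; split.
  apply: P_le => z Zz; apply: le_trans (P_ge Zy s0 Zz); apply: ler_wpM2l => //.
  by rewrite ge_max !le_max lexx orbT andbT; apply/orP; left; lra.
have e0 : 0 <= 2 * e * (s - t).
  have [->|st] := eqVneq s t; first by rewrite subrr mulr0.
  have s0' : 0 < s by rewrite (le_lt_trans t0) // lt_neqAle eq_sym st.
  have := he y Zy; rewrite subrr normr0 mulr_gt0 // => /(_ isT).
  by have := rho_ge0 y y; nra.
rewrite lerBlDr; apply: P_le => z Zz.
have [zy|zy] := ltP `|z - y| (2 * s); last first.
  rewrite /term max_r ?mulr0; last lra.
  rewrite addr_ge0 // (le_trans _ (P_ge Zy t0 Zz)) // mulr_ge0 //.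
  by rewrite le_max lexx orbT.
apply: (@le_trans _ _ (rho y z * (2 * (s - t)) + term y t z)); last first.
  by apply: lerD; [have := he z Zz zy; nra|exact: P_ge].
rewrite /term -mulrDr; apply: ler_wpM2l => //.
by rewrite ge_max; case: (leP (2 * t - `|z - y|) 0) => ?; apply/andP; split; lra.
Qed.

(** Flat at 0, so that it does not affect derivatives; of slope at most 1, so that [q y] stays
    globally Lipschitz; positive elsewhere, so that distant [y] lose in the infimum. *)
Let kappa t := t ^+ 2 / (1 + t).

Let kappa_lip s a b : 0 <= b -> b <= a -> a <= s ->
  0 <= kappa a - kappa b <= Num.min 1 (2 * s) * (a - b).
Proof.
move=> b0 ba as_; have a0 : 0 <= a by exact: le_trans ba.
have h : 0 < (1 + a) * (1 + b) by rewrite mulr_gt0 //; lra.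
have E : kappa a - kappa b = (a - b) * ((a + b + a * b) / ((1 + a) * (1 + b))).
  rewrite /kappa; field; apply/andP; split; rewrite gt_eqF //; lra.
have ab : 0 <= a * b by exact: mulr_ge0.
rewrite E; apply/andP; split.
  by rewrite mulr_ge0 ?subr_ge0 // divr_ge0 ?(ltW h) // !addr_ge0.
rewrite mulrC ler_wpM2r ?subr_ge0 // ler_pdivrMr //.
case: (leP 1 (2 * s)) => _; first by lra.
by nra.
Qed.

Let q y x := f y + T y (x - y) + P y `|x - y| + kappa `|x - y|.

(** The three summands of the constant come from [T y], from [P y] and from [kappa]. The estimate is
    one-sided because [a] and [b] can be exchanged. *)
Let q_diff L y s e e' a b : Z y -> bounded_linear L ->
  `|a - y| <= s -> `|b - y| <= s ->
  (forall z, Z z -> `|z - y| < 2 * s -> rho y z <= e) ->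
  (forall v, `|T y v - L v| <= e' * `|v|) ->
  (q y a - L a) - (q y b - L b) <= (e' + 2 * e + Num.min 1 (2 * s)) * `|a - b|.
Proof.
move=> Zy bL as_ bs he TL; have bTy := bT Zy.
have e0 : 0 <= e * `|a - b|.
  have [->|ab] := eqVneq a b; first by rewrite subrr normr0 mulr0.
  rewrite mulr_ge0 // (le_trans (rho_ge0 y y)) // he // subrr normr0.
  rewrite mulr_gt0 // lt_neqAle (le_trans (normr_ge0 _) as_) andbT eq_sym.
  apply: contra_neqN ab => /eqP s0; move: as_ bs.
  by rewrite s0 !normr_le0 !subr_eq0 => /eqP -> /eqP ->.
have m0 : 0 <= Num.min 1 (2 * s).
  by rewrite le_min ler01 mulr_ge0 // (le_trans _ as_).
have Tab : T y (a - y) - L a - (T y (b - y) - L b) <= e' * `|a - b|.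
  rewrite (le_trans _ (TL (a - b))) // (le_trans _ (ler_norm _)) //.
  by rewrite !(linB _ _ bTy) (linB _ _ bL); lra.
have Pab : P y `|a - y| - P y `|b - y| <= 2 * (e * `|a - b|) /\
    kappa `|a - y| - kappa `|b - y| <= Num.min 1 (2 * s) * `|a - b|.
  have [ab|/ltW ab] := leP `|b - y| `|a - y|.
    have h : `|a - y| - `|b - y| <= `|a - b|.
      by have := lerB_dist (a - y) (b - y); rewrite opprB addrA subrK.
    have he' z : Z z -> `|z - y| < 2 * `|a - y| -> rho y z <= e.
      by move=> Zz zy; apply: he => //; lra.
    have /andP[_ h1] := P_lip Zy (normr_ge0 _) ab he'.
    have /andP[_ h2] := kappa_lip (normr_ge0 _) ab as_.
    split; last by apply: (le_trans h2); exact: ler_wpM2l.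
    apply: (le_trans h1); have [ab0|ab0] := eqVneq `|a - y| `|b - y|.
      by rewrite ab0 subrr mulr0 mulr_ge0.
    have e0' : 0 <= e.
      rewrite (le_trans (rho_ge0 y y)) // he' // subrr normr0 mulr_gt0 //.
      by rewrite (le_lt_trans (normr_ge0 (b - y))) // lt_neqAle eq_sym ab0.
    by rewrite -mulrA ler_wpM2l // ler_wpM2l.
  have he' z : Z z -> `|z - y| < 2 * `|b - y| -> rho y z <= e.
    by move=> Zz zy; apply: he => //; lra.
  have /andP[h1 _] := P_lip Zy (normr_ge0 _) ab he'.
  have /andP[h2 _] := kappa_lip (normr_ge0 _) ab bs.
  split; first by rewrite (le_trans (y := 0)) //; [lra|rewrite mulr_ge0].
  by rewrite (le_trans (y := 0)) //; [lra|rewrite mulr_ge0].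
by rewrite /q; have [] := Pab; lra.
Qed.

(** [K] for [T y], [2 * (2 * K)] for [P y] since [rho] is at most [2 * K], and 1 for [kappa]. *)
Let M := 5 * K + 1.

Let M0 : 0 < M.
Proof. by rewrite /M addr_gt0 // mulr_gt0. Qed.

Let q_lip y a b : Z y -> q y a - q y b <= M * `|a - b|.
Proof.
move=> Zy.
have := @q_diff (fun=> 0) y (Num.max `|a - y| `|b - y|) (2 * K) K a b Zy
  bounded_linear0; rewrite !le_max !lexx orbT !subr0 => h.
apply: (le_trans (h isT isT _ _)).
- by move=> z Zz _; exact: rho_leK.
- by move=> v; rewrite subr0; exact: TK.
rewrite ler_wpM2r // /M.
have : Num.min 1 (2 * Num.max `|a - y| `|b - y|) <= 1 :> R by rewrite ge_min lexx.
lra.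
Qed.

Let q_id y : Z y -> q y y = f y.
Proof.
by move=> Zy; rewrite /q subrr normr0 P_0 // (lin0 (bT Zy)) /kappa expr0n mul0r !addr0.
Qed.

Let q_ge y z : Z y -> Z z -> f z + kappa `|z - y| <= q y z.
Proof. by move=> Zy Zz; have /ler_normlP[_] := P_interp Zy Zz; rewrite /q; lra. Qed.

Let kappa_ge0 t : 0 <= t -> 0 <= kappa t.
Proof. by move=> t0; rewrite divr_ge0 ?sqr_ge0 // addr_ge0. Qed.

Let F x := inf (q^~ x @` Z).

Let q_lb x z y : Z z -> Z y -> f z - M * `|x - z| <= q y x.
Proof.
move=> Zz Zy; have := q_ge Zy Zz; have := kappa_ge0 (normr_ge0 (z - y)).
by have := q_lip z x Zy; rewrite distrC; lra.
Qed.

Let F_le x y : Z y -> F x <= q y x.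
Proof. by have [z Zz] := Z0; apply: inf_on_le => y' Zy'; exact: q_lb Zz Zy'. Qed.

Let F_ge x m : (forall y, Z y -> m <= q y x) -> m <= F x.
Proof. exact: inf_on_ge. Qed.

(** A competitor [y] at [b] may be exchanged for a better one [y'] before moving to [a]; this
    disposes of the [y] far from the point under study. *)
Let F_diff L a b e : (forall y, Z y -> exists2 y', Z y' &
    q y' b <= q y b /\ (q y' a - L a) - (q y' b - L b) <= e) ->
  (F a - L a) - (F b - L b) <= e.
Proof.
move=> H; suff : F a - L a + L b - e <= F b by lra.
apply: F_ge => y Zy; have [y' Zy' [h1 h2]] := H y Zy.
by have := F_le a Zy'; lra.
Qed.

Lemma whitney_extension : exists F : V -> R,
  [/\ forall y, Z y -> F y = f y, lipschitz_fun F &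
      forall y, Z y -> sdiff F y (T y)].
Proof.
exists F; split.
- move=> y Zy; apply/eqP; rewrite eq_le -{1}(q_id Zy) F_le //=.
  by apply: F_ge => z Zz; have := q_lb y Zy Zz; rewrite subrr normr0 mulr0 subr0.
- exists M => [|a b]; first exact: ltW.
  have h a' b' : F a' - F b' <= M * `|a' - b'|.
    have := @F_diff (fun=> 0) a' b' (M * `|a' - b'|); rewrite !subr0; apply.
    by move=> y Zy; exists y => //; rewrite !subr0; split => //; exact: q_lip.
  by rewrite ler_norml h andbT lerNl opprB distrC h.
move=> y0 Zy0; split=> [|e e0]; first exact: bT.
have e1 : 0 < e / 4 by rewrite divr_gt0.
have [d d0 dP] := jet Zy0 e1.
(* For [z] within [s] of [y0], the points [a] and [b] are within [2 * s] of [z], and [q_diff] then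
   looks at points of [Z] within [4 * s] of [z], hence within [5 * s <= d] of [y0]. *)
pose s := Num.min d (e / 4) / 8.
have s0 : 0 < s by rewrite divr_gt0 // lt_min d0 e1.
have sd : 8 * s <= d by rewrite /s mulrC divfK // ge_min lexx.
have se : 8 * s <= e / 4 by rewrite /s mulrC divfK // ge_min lexx orbT.
have ks : 0 < kappa s by rewrite divr_gt0 ?exprn_gt0 //; lra.
pose r := Num.min s (kappa s / (2 * M)).
have r0 : 0 < r by rewrite lt_min s0 divr_gt0 // mulr_gt0.
have rs : r <= s by rewrite ge_min lexx.
have rk : 2 * M * r <= kappa s.
  by rewrite mulrC -ler_pdivlMr ?mulr_gt0 // ge_min lexx orbT.
have key a b : `|a - y0| < r -> `|b - y0| < r ->
    (F a - T y0 a) - (F b - T y0 b) <= e * `|a - b|.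
  move=> ar br; apply: F_diff => y Zy.
  have near_y0 z : Z z -> `|z - y0| <= s ->
      (q z a - T y0 a) - (q z b - T y0 b) <= e * `|a - b|.
    move=> Zz zs.
    have dist2 u : `|u - y0| < r -> `|u - z| <= 2 * s.
      move=> ur; rewrite -(subrKA y0) (le_trans (ler_normD _ _)) //.
      by rewrite (distrC y0); lra.
    have zd : `|z - y0| < d by lra.
    have h := @q_diff (T y0) z (2 * s) (e / 4) (e / 4) a b Zz (bT Zy0)
      (dist2 a ar) (dist2 b br).
    apply: (le_trans (h _ _)).
    - move=> z' Zz' zz'; apply: rho_le => //; first exact: ltW.
      apply: (dP z z' Zz Zz' zd _).1.
      rewrite -(subrKA z) (le_lt_trans (ler_normD _ _)) //; lra.
    - by move=> v; have [_] := dP z z Zz Zz zd zd; apply.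
    - rewrite ler_wpM2r //.
      have : Num.min 1 (2 * (2 * s)) <= 2 * (2 * s) by rewrite ge_min lexx orbT.
      lra.
  have [ys|ys] := leP `|y - y0| s; first by exists y => //; split => //; exact: near_y0.
  (* A far [y] is replaced by [y0]: [q y b >= f y0 + kappa s - M * r >= f y0 + M * r >= q y0 b], by
     the choice of [r]. *)
  exists y0 => //; split; last by apply: near_y0; rewrite // subrr normr0 ltW.
  have h1 := q_lip b y0 Zy0; rewrite q_id // in h1.
  have h2 := q_lip y0 b Zy; have h3 := q_ge Zy Zy0.
  have /andP[h4 _] := kappa_lip (ltW s0) (ltW ys) (lexx _).
  rewrite distrC in h3; rewrite distrC in h2.
  have : M * `|b - y0| <= M * r by rewrite ler_wpM2l // ltW.
  lra.
move: (near_both (near_norm y0 r0)); apply: filterS => -[a b] /= [ar br].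
by rewrite ler_norml (key a b ar br) andbT lerNl opprB distrC key.
Qed.

End WhitneyExtension.

(** * Gluing with a partition of unity *)

Section Gluing.
Context {R : realType} {V : normedModType R}.

Lemma smooth_sum n (f : nat -> V -> R) : (forall i, smooth (f i)) ->
  smooth (fun x => \sum_(i < n) f i x).
Proof.
move=> sf; elim: n => [|n IH].
  rewrite (_ : (fun _ => _) = fun=> 0); first exact: smooth_cst.
  by apply/funext => x; rewrite big_ord0.
rewrite (_ : (fun _ => _) = (fun x => \sum_(i < n) f i x) \+ f n); first exact: smoothD.
by apply/funext => x; rewrite big_ord_recr.
Qed.

Variables (U : set V) (phi : nat -> V -> R) (k : V -> nat).
Hypothesis U_open : open U.
Hypothesis phi_sum : forall x, U x -> \forall z \near x,
  forall n, (k x <= n)%N -> \sum_(i < n) phi i z = 1.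

Definition glue (h : nat -> V -> R) x := \sum_(i < k x) phi i x * h i x.

(** The number of terms in [glue] varies from point to point; near [x] it can be frozen at [k x]. *)
Lemma glueE h x : U x ->
  \forall z \near x, glue h z = \sum_(i < k x) phi i z * h i z.
Proof.
move=> Ux; move: (open_nbhs_nbhs (conj U_open Ux)) (phi_sum Ux).
apply: filterS2 => z Uz zx.
apply: (@partition_sum_stable R (fun i => phi i z) (fun i => h i z)) => //.
exact: (nbhs_singleton (phi_sum Uz)).
Qed.

Lemma glue_sdiff h x : (forall i, smooth (phi i)) -> (forall i, smooth (h i)) ->
  U x -> exists L, sdiff (glue h) x L.
Proof.
move=> sphi sh Ux.
have [L gL] := smooth_sum (k x) (fun i => smoothM (sphi i) (sh i)) x.
by exists L; apply: sdiff_eq gL; near=> z; apply/esym; near: z; exact: glueE.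
Unshelve. all: by end_near. Qed.

End Gluing.

(** * Smoothing off a closed set, keeping the derivative on it *)

Section SmoothOffClosedSet.
Context {R : realType} {V : normedModType R}.
Implicit Types (x y z v : V) (F L : V -> R) (d e K : R).
Variables (N : V -> R) (C : R).
Hypotheses (NC : gauge N C) (C0 : 0 < C).
Variable xs : nat -> V.
Hypothesis xs_dense : forall x e, 0 < e -> exists n, `|x - xs n| < e.

Lemma lipschitz_smooth_approx F K e : 0 < K -> 0 < e ->
  (forall a b, `|F a - F b| <= K * `|a - b|) ->
  exists G, [/\ smooth G, forall x, `|G x - F x| <= e &
                forall a b, `|G a - G b| <= 5 * C * K * `|a - b|].
Proof.
move=> K0 e0 FK; have eK : 0 < e / K by rewrite divr_gt0.
have [|G [sG GF GC]] :=
  @nonexpansive_smooth_approx _ _ N C NC C0 xs xs_dense (fun x => K^-1 * F x) _ eK.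
  move=> a b; rewrite -mulrBr normrM gtr0_norm ?invr_gt0 //.
  by rewrite ler_pdivrMl.
exists (fun x => K * G x); split; first exact: smoothZ.
  move=> x; rewrite -[F x](mulVKf (lt0r_neq0 K0)) -mulrBr normrM gtr0_norm //.
  by rewrite mulrC -ler_pdivlMr.
move=> a b; rewrite -mulrBr normrM gtr0_norm // (mulrC _ K) -mulrA.
by rewrite ler_pM2l.
Qed.

Lemma mcshane (B : set V) F K : B !=set0 -> 0 <= K ->
  (forall a b, B a -> B b -> `|F a - F b| <= K * `|a - b|) ->
  exists D, (forall x, B x -> D x = F x) /\
    forall a b, `|D a - D b| <= K * `|a - b|.
Proof.
move=> [b0 Bb0] K0 FK.
pose D x := inf ((fun b => F b + K * `|x - b|) @` B).
have lb x b : B b -> F b0 - K * `|x - b0| <= F b + K * `|x - b|.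
  move=> Bb; have /ler_normlP[_] := FK _ _ Bb0 Bb.
  have := ler_distD x b0 b; rewrite (distrC b0 x); nra.
have D_le x b : B b -> D x <= F b + K * `|x - b|.
  by move=> Bb; apply: (inf_on_le (f := fun b => F b + K * `|x - b|) (lb x)).
have D_ge x m : (forall b, B b -> m <= F b + K * `|x - b|) -> m <= D x.
  by move=> mb; apply: inf_on_ge => //; exists b0.
exists D; split=> [x Bx|a b].
  apply/eqP; rewrite eq_le; apply/andP; split.
    by rewrite (le_trans (D_le x x Bx)) // subrr normr0 mulr0 addr0.
  by apply: (D_ge) => b Bb; have /ler_normlP[_] := FK _ _ Bx Bb; lra.
have h u v : D u - D v <= K * `|u - v|.
  suff : D u - K * `|u - v| <= D v by lra.
  apply: (D_ge) => c Bc; rewrite lerBlDr (le_trans (D_le u c Bc)) //.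
  by rewrite -addrA lerD2l -mulrDr ler_wpM2l // [leRHS]addrC ler_distD.
by rewrite ler_norml h andbT lerNl opprB distrC h.
Qed.

(** The constant [K] is valid on [B] only, whereas the approximation needs a globally Lipschitz
    function; McShane's extension bridges the gap. *)
Lemma lipschitz_on_smooth_approx (B : set V) F K e : B !=set0 -> 0 < K -> 0 < e ->
  (forall a b, B a -> B b -> `|F a - F b| <= K * `|a - b|) ->
  exists G, [/\ smooth G, forall x, B x -> `|G x - F x| <= e &
                forall a b, `|G a - G b| <= 5 * C * K * `|a - b|].
Proof.
move=> B0 K0 e0 FK; have [D [DF DK]] := mcshane B0 (ltW K0) FK.
have [G [sG GD GK]] := lipschitz_smooth_approx K0 e0 DK.
by exists G; split => // x /DF <-.
Qed.

Let affine_lip F L (B : set V) K := [/\ 0 <= K, bounded_linear L &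
  forall a b, B a -> B b -> `|(F a - L a) - (F b - L b)| <= K * `|a - b|].

(** The functional is chosen without reference to [Z]. When the ball is close to a point [y] of [Z],
    [T y] competes with it, so its constant [K] is automatically small; no nearest point of [Z] has
    to be selected. *)
Let best_affine F x d : 0 < d -> lipschitz_fun F -> exists L K,
  affine_lip F L [set z | `|z - x| < d] K /\
  forall L' K', affine_lip F L' [set z | `|z - x| < d] K' -> K <= K' + d.
Proof.
move=> d0 [M M0 FM].
pose S := [set K | exists L, affine_lip F L [set z | `|z - x| < d] K].
have hS : has_inf S.
  split; last by exists 0 => K [L []].
  exists M, (fun=> 0); split => //; first exact: bounded_linear0.
  by move=> a b _ _; rewrite !subr0.
have [K [L LK] KS] := inf_adherent d0 hS.
exists L, K; split=> // L' K' LK'; rewrite (le_trans (ltW KS)) // lerD2r.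
by apply: ge_inf; [case: hS|exists L'].
Qed.

Let affine_lip_diff F L1 L2 x d K1 K2 : 0 < d ->
  affine_lip F L1 [set z | `|z - x| < d] K1 ->
  affine_lip F L2 [set z | `|z - x| < d] K2 ->
  forall v, `|L1 v - L2 v| <= (K1 + K2) * `|v|.
Proof.
move=> d0 [_ b1 F1] [_ b2 F2].
have b12 := bounded_linearB b1 b2; apply: (sdiff_le (sdiff_lin x b12)).
move: (near_both (near_norm x d0)); apply: filterS => -[a b] /= [ax bx].
rewrite (_ : _ - _ - _ = ((F a - L2 a) - (F b - L2 b)) - ((F a - L1 a) - (F b - L1 b)));
  last by ring.
by rewrite (le_trans (ler_normB _ _)) // mulrDl addrC lerD // ?F1 // F2.
Qed.

Variables (Z : set V) (F : V -> R) (T : V -> V -> R).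
Hypothesis Z_closed : closed Z.
Hypothesis F_lip : lipschitz_fun F.
Hypothesis F_sdiff : forall y, Z y -> sdiff F y (T y).

Let U := ~` Z.

(** On each ball it is [F] minus its near-best functional that is smoothed: the factor [5 * C] then
    multiplies a constant which is small near [Z], instead of the Lipschitz constant of [F]. *)
Let off_approx : U !=set0 -> exists g : V -> R,
  [/\ forall x, U x -> exists L, sdiff g x L,
      forall x y, U x -> Z y -> `|g x - F x| <= `|x - y| ^+ 2 &
      forall y e, Z y -> 0 < e -> exists2 d, 0 < d & forall x, U x -> `|x - y| < d ->
        lip_near x e (g \- T y)].
Proof.
move=> U0; have U_open : open U by exact: closed_openC.
have /choice[r rP] : forall x, exists r, U x -> 0 < r /\ forall y, Z y -> 2 * r <= `|x - y|.
  move=> x; have [Ux|nUx] := pselect (U x); last by exists 0.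
  have [d d0 dU] := norm_near (open_nbhs_nbhs (conj U_open Ux)).
  exists (d / 2) => _; split=> [|y Zy]; first by rewrite divr_gt0.
  by rewrite leNgt; apply/negP => xy; have := dU y; rewrite distrC; apply => //; lra.
have [c [phi [cU phi_s phi0 phi_supp]]] :=
  partition_of_unity NC C0 xs_dense U0 (fun x Ux => (rP x Ux).1).
move=> phi_sum.
have /choice[k kP] : forall x : V, exists k, U x -> \forall z \near x,
    forall n, (k <= n)%N -> \sum_(i < n) phi i z = 1.
  move=> x; have [Ux|nUx] := pselect (U x); last by exists 0%N.
  by have [k kP] := phi_sum x Ux; exists k.
have rc i : 0 < r (c i) := (rP _ (cU i)).1.
pose B i := [set z | `|z - c i| < r (c i)].
have /choice[M MP] : forall i, exists M, 0 <= M /\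
    forall a b, `|phi i a - phi i b| <= M * `|a - b|.
  by move=> i; have [_ [M M0 phiM]] := phi_s i; exists M.
(* The square gives the quadratic closeness to [F] near [Z]; the other factor makes the errors due
   to the variation of the [phi i] summable, [M i] being the Lipschitz constant of [phi i]. *)
pose eta i := r (c i) ^+ 2 * ((2 ^+ i.+1)^-1 / (M i + 1)).
have M1 i : 0 < M i + 1 by have [] := MP i; lra.
have pw i : 0 < (2 ^+ i.+1)^-1 :> R by rewrite invr_gt0 exprn_gt0.
have eta0 i : 0 < eta i by rewrite mulr_gt0 ?exprn_gt0 // divr_gt0.
have /choice[LK LKP] : forall i, exists LK : (V -> R) * R,
    affine_lip F LK.1 (B i) LK.2 /\
    forall L' K', affine_lip F L' (B i) K' -> LK.2 <= K' + r (c i).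
  by move=> i; have [L [K LKP]] := best_affine (c i) (rc i) F_lip; exists (L, K).
have KR i : 0 < (LK i).2 + r (c i).
  by rewrite ltr_wpDl //; have [[]] := LKP i.
have /choice[G GP] : forall i, exists G, [/\ smooth G,
    forall x, B i x -> `|G x - (F x - (LK i).1 x)| <= eta i &
    forall a b, `|G a - G b| <= 5 * C * ((LK i).2 + r (c i)) * `|a - b|].
  move=> i; apply: (@lipschitz_on_smooth_approx (B i) (F \- (LK i).1)) => //.
    by exists (c i); rewrite /B /= subrr normr0.
  move=> a b Ba Bb; have [[K0 _ FL] _] := LKP i.
  by rewrite (le_trans (FL a b Ba Bb)) // ler_wpM2r // lerDl ltW.
pose h i x := (LK i).1 x + G i x.
have sh i : smooth (h i).
  apply: smoothD; last by have [] := GP i.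
  by move=> x; exists (LK i).1; apply: sdiff_lin; have [[]] := LKP i.
have hF i x : B i x -> `|h i x - F x| <= eta i.
  by have [_ + _] := GP i => /[apply]; rewrite /h; congr (`|_| <= _); ring.
have suppB i x : phi i x != 0 -> B i x.
  by move=> /phi_supp xi; rewrite /B /=; have := rc i; lra.
have suppZ i x y : phi i x != 0 -> Z y -> r (c i) <= `|x - y|.
  move=> /phi_supp xi Zy; have := (rP _ (cU i)).2 y Zy.
  have := ler_distD x (c i) y; rewrite (distrC (c i) x); have := rc i; lra.
have phi1 x : U x -> \sum_(i < k x) phi i x = 1.
  by move=> Ux; exact: (nbhs_singleton (kP x Ux)).
exists (glue phi k h); split.
- by move=> x; apply: (glue_sdiff U_open kP) => // i; have [] := phi_s i.
- move=> x y Ux Zy.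
  apply: (@convex_sum_le R (fun i => phi i x) (fun i => h i x)) => //; first exact: phi1.
  move=> i xi; apply: (le_trans (hF i x (suppB i x xi))).
  have rxy := suppZ i x y xi Zy.
  apply: (@le_trans _ _ (r (c i) ^+ 2)); last by rewrite lerXn2r ?nnegrE // ltW.
  rewrite /eta ler_piMr ?sqr_ge0 // ler_pdivrMr // mul1r.
  have : (2 ^+ i.+1)^-1 <= 1 :> R by rewrite invf_le1 ?exprn_gt0 // exprn_ege1 // ler1n.
  by have [] := MP i; lra.
move=> y e Zy e0.
have C4 : 0 < 4 + 15 * C by rewrite addr_gt0 // mulr_gt0.
(* The variation of the [h i] costs [3 + 15 * C] times [e1], and that of the weights [e1]. *)
pose e1 := e / (4 + 15 * C); have e10 : 0 < e1 by rewrite divr_gt0.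
have eE : e = (4 + 15 * C) * e1 by rewrite /e1 mulrC divfK // gt_eqF.
have [bTy FT] := F_sdiff Zy.
have [d0 d00 FTd] := near_diag (FT _ e10).
(* Balls whose weight is nonzero within [d] of [y] have radius at most [d], so they stay within
   [3 * d] of [y]; the bound 1 makes the squared radius at most the radius. *)
pose d := Num.min (Num.min (d0 / 3) e1) 1.
have dpos : 0 < d by rewrite !lt_min divr_gt0 // e10 ltr01.
have dd0 : 3 * d <= d0.
  by rewrite mulrC -ler_pdivlMr // !ge_min lexx.
have de1 : d <= e1 by rewrite !ge_min lexx orbT.
have d1 : d <= 1 by rewrite !ge_min lexx !orbT.
exists d => // x Ux xy.
set n := k x.
(* A weight may be nonzero at one point only, while [h i] is close to [F] only on [B i]. As the
   support has half the radius of [B i], this causes no harm near [x]. *)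
have dich i : \forall p \near (x, x), phi i p.1 = 0 /\ phi i p.2 = 0 \/
    B i p.1 /\ B i p.2.
  have [xi|xi] := ltP `|x - c i| (r (c i)).
    have xi' : 0 < r (c i) - `|x - c i| by rewrite subr_gt0.
    move: (near_both (near_norm x xi')); apply: filterS => -[a b] /= [ax bx].
    right; split; rewrite /B /=.
      by have := ler_distD x a (c i); lra.
    by have := ler_distD x b (c i); lra.
  have r2 : 0 < r (c i) / 2 by rewrite divr_gt0.
  move: (near_both (near_norm x r2)); apply: filterS => -[a b] /= [ax bx].
  left; split; apply/eqP/negPn/negP => /phi_supp.
    by have := ler_distD a x (c i); rewrite (distrC x a); lra.
  by have := ler_distD b x (c i); rewrite (distrC x b); lra.
have dichn : \forall p \near (x, x), forall i : 'I_n, phi i p.1 = 0 /\ phi i p.2 = 0 \/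
    B i p.1 /\ B i p.2.
  exact: (@filter_forall _ 'I_n (fun i p => phi i p.1 = 0 /\ phi i p.2 = 0 \/
    B i p.1 /\ B i p.2) _ _ (fun i => dich i)).
have xd : 0 < d - `|x - y| by rewrite subr_gt0.
have eu : \forall z \near x, [/\ `|z - x| < d - `|x - y|,
    glue phi k h z = \sum_(i < n) phi i z * h i z &
    forall m, (n <= m)%N -> \sum_(i < m) phi i z = 1].
  move: (near_norm x xd) (glueE U_open kP h Ux) (kP x Ux).
  by apply: filterS3 => z; split.
move: (near_both eu) dichn.
apply: filterS2 => -[a b] /= [[ax ga phia] [bx gb phib]] ab.
have ay : `|a - y| < d by have := ler_distD x a y; lra.
have by_ : `|b - y| < d by have := ler_distD x b y; lra.
rewrite ga gb -/n.
have sa : \sum_(i < n) phi i a = 1 by exact: phia.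
have sb : \sum_(i < n) phi i b = 1 by exact: phib.
(* As the phi i sum to 1 at a and at b, F b can be subtracted from h i b. *)
have E : \sum_(i < n) phi i a * h i a - T y a - (\sum_(i < n) phi i b * h i b - T y b) =
  (\sum_(i < n) phi i a * (h i a - h i b) - T y (a - b)) +
  \sum_(i < n) (phi i a - phi i b) * (h i b - F b).
  have -> : \sum_(i < n) (phi i a - phi i b) * (h i b - F b) =
    \sum_(i < n) phi i a * h i b - \sum_(i < n) phi i b * h i b.
    transitivity (\sum_(i < n) phi i a * h i b - \sum_(i < n) phi i b * h i b -
      (\sum_(i < n) phi i a - \sum_(i < n) phi i b) * F b).
      by rewrite -!sumrB mulr_suml -sumrB; apply: eq_bigr => i _; ring.
    by rewrite sa sb subrr mul0r subr0.
  have -> : \sum_(i < n) phi i a * (h i a - h i b) =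
    \sum_(i < n) phi i a * h i a - \sum_(i < n) phi i a * h i b.
    by rewrite -sumrB; apply: eq_bigr => i _; rewrite mulrBr.
  by rewrite (linB _ _ bTy); ring.
rewrite E (le_trans (ler_normD _ _)) //.
have smallB i z : phi i z != 0 -> `|z - y| < d -> r (c i) <= d /\
    forall u, B i u -> `|u - y| < d0.
  move=> zi zy; have ry := suppZ i z y zi Zy; split; first lra.
  move=> u; rewrite /B /= => ui; have := phi_supp i z zi => zi'.
  have := ler_distD (c i) u y; have := ler_distD z (c i) y; rewrite (distrC (c i) z).
  lra.
have h1 : `|\sum_(i < n) phi i a * (h i a - h i b) - T y (a - b)| <=
    (3 + 15 * C) * e1 * `|a - b|.
  apply: (@convex_sum_le R (fun i => phi i a) (fun i => h i a - h i b)) => //.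
  move=> i ai; have [rd Bd0] := smallB i a ai ay.
  have FTB : affine_lip F (T y) (B i) e1.
    split=> //; first exact: ltW.
    by move=> u v Bu Bv; exact: (FTd u v (Bd0 u Bu) (Bd0 v Bv)).
  have [FLB Kmin] := LKP i; have K2 : (LK i).2 <= 2 * e1.
    by have := Kmin _ _ FTB; lra.
  have hL := affine_lip_diff (rc i) FLB FTB (a - b).
  have [_ _ /(_ a b) hG] := GP i; have [_ bL _] := FLB.
  have n0 := normr_ge0 (a - b).
  rewrite /h (_ : _ - _ = ((LK i).1 (a - b) - T y (a - b)) + (G i a - G i b)); last first.
    by rewrite (linB _ _ bL); ring.
  rewrite (le_trans (ler_normD _ _)) //.
  have hL' : ((LK i).2 + e1) * `|a - b| <= 3 * e1 * `|a - b|.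
    by rewrite ler_wpM2r //; lra.
  have hG' : 5 * C * ((LK i).2 + r (c i)) * `|a - b| <= 15 * C * e1 * `|a - b|.
    rewrite ler_wpM2r // -!mulrA (_ : 15 * (C * e1) = 5 * (C * (3 * e1))); last by ring.
    by rewrite !ler_wpM2l ?(ltW C0) //; lra.
  by lra.
have h2 : `|\sum_(i < n) (phi i a - phi i b) * (h i b - F b)| <= e1 * `|a - b|.
  rewrite (le_trans (ler_norm_sum _ _ _)) //.
  apply: (@le_trans _ _ (\sum_(i < n) (2 ^+ i.+1)^-1 * (e1 * `|a - b|))); last first.
    have n1 : 0 <= e1 * `|a - b| by rewrite mulr_ge0 // ltW.
    rewrite -mulr_suml ler_piMl //.
    rewrite sum_half_pow.
    by rewrite gerBl invr_ge0 exprn_ge0.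
  apply: ler_sum => i _.
  have n2 : 0 <= (2 ^+ i.+1)^-1 * (e1 * `|a - b|).
    by apply: mulr_ge0; [exact: ltW|rewrite mulr_ge0 // ltW].
  have [[-> ->]|[Ba Bb]] := ab i.
    by rewrite subrr mul0r normr0.
  have [->|pab] := eqVneq (phi i a) (phi i b).
    by rewrite subrr mul0r normr0.
  have rd : r (c i) <= d.
    have [a0|a0] := eqVneq (phi i a) 0; last by have [] := smallB i a a0 ay.
    by have [] := smallB i b _ by_; rewrite // -a0 eq_sym.
  have etae : M i * eta i <= (2 ^+ i.+1)^-1 * e1.
    have r2 : r (c i) ^+ 2 <= e1.
      by have := rc i; rewrite expr2; nra.
    have : M i / (M i + 1) <= 1 by rewrite ler_pdivrMr // mul1r lerDl.
    have q0 : 0 <= M i / (M i + 1) by rewrite divr_ge0 ?(ltW (M1 i)) //; have [] := MP i.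
    have -> : M i * eta i = (2 ^+ i.+1)^-1 * (r (c i) ^+ 2 * (M i / (M i + 1))).
      by rewrite /eta; ring.
    move=> q1; rewrite ler_wpM2l ?(ltW (pw i)) //.
    by rewrite (le_trans _ r2) // ler_piMr // sqr_ge0.
  rewrite normrM (le_trans (ler_pM _ _ ((MP i).2 a b) (hF i b Bb))) //.
  by rewrite mulrAC [leRHS]mulrA ler_wpM2r.
by rewrite eE; lra.
Qed.

Lemma smooth_off_closed : exists g : V -> R, smooth g /\ forall y, Z y -> g y = F y.
Proof.
have [U0|U0] := pselect (U !=set0); last first.
  exists F; split => // x; exists (T x); apply: F_sdiff.
  by apply: contrapT => nZx; apply: U0; exists x.
have [g0 [g0_s g0_F g0_T]] := off_approx U0.
pose g x := if pselect (Z x) then F x else g0 x.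
have gZ y : Z y -> g y = F y by rewrite /g; case: pselect.
have gU x : U x -> g x = g0 x by rewrite /g; case: pselect.
have U_open : open U by exact: closed_openC.
have gU_near x : U x -> \forall z \near x, g0 z = g z.
  move=> Ux; move: (open_nbhs_nbhs (conj U_open Ux)).
  by apply: filterS => z Uz; rewrite gU.
have gF x y : Z y -> `|g x - F x| <= `|x - y| ^+ 2.
  move=> Zy; have [Zx|Ux] := pselect (Z x); last by rewrite gU //; exact: g0_F.
  by rewrite gZ // subrr normr0 sqr_ge0.
exists g; split => // x.
have [Zx|Ux] := pselect (Z x); last first.
  by have [L g0L] := g0_s x Ux; exists L; apply: sdiff_eq g0L; exact: gU_near.
exists (T x); have [bTx FT] := F_sdiff Zx; split => // e e0.
have e2 : 0 < e / 2 by rewrite divr_gt0.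
have [d d0 dT] := g0_T x e Zx e0.
have [d' d'0 d'F] := near_diag (FT _ e2).
(* The bound [e / 4] gives [|a - b| <= e / 2], so that an error of [|a - b| ^+ 2] uses up only half
   of [e]. *)
pose s := Num.min (Num.min d d') (e / 4).
have s0 : 0 < s by rewrite !lt_min d0 d'0 divr_gt0.
have sd : s <= d by rewrite !ge_min lexx.
have sd' : s <= d' by rewrite !ge_min lexx orbT.
have se : s <= e / 4 by rewrite !ge_min lexx orbT.
move: (near_both (near_norm x s0)); apply: filterS => -[a b] /= [ax bx].
(* If the segment from b to a meets Z, then |g - F| is quadratically small at a
   and b; otherwise g \- T x is locally e-Lipschitz along the segment. *)
have [[t [t01 Zt]]|noZ] := pselect (exists t : R, 0 <= t <= 1 /\ Z (b + t *: (a - b))).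
  set p := b + _ in Zt; have /andP[t0 t1] := t01.
  have ga := gF a p Zt; have gb := gF b p Zt.
  have ap : `|a - p| = (1 - t) * `|a - b|.
    have -> : a - p = (1 - t) *: (a - b).
      by rewrite scalerBl scale1r /p opprD addrA.
    by rewrite normrZ ger0_norm // subr_ge0.
  have bp : `|b - p| = t * `|a - b|.
    by rewrite /p opprD addrA subrr add0r normrN normrZ ger0_norm.
  rewrite ap in ga; rewrite bp in gb.
  have := d'F a b (lt_le_trans ax sd') (lt_le_trans bx sd') => /= FTab.
  have ab : `|a - b| <= e / 2.
    by have := ler_distD x a b; rewrite (distrC x b); lra.
  rewrite (_ : _ - _ - _ = (F a - T x a - (F b - T x b)) + (g a - F a) - (g b - F b));
    last by ring.
  rewrite (le_trans (ler_normB _ _)) // (le_trans (lerD (ler_normD _ _) (lexx _))) //.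
  have := normr_ge0 (a - b).
  move: ga gb FTab; rewrite !exprMn; move: `|a - b| ab => n nle.
  have tt : (1 - t) ^+ 2 + t ^+ 2 <= 1 by nra.
  have nn : ((1 - t) ^+ 2 + t ^+ 2) * n ^+ 2 <= n ^+ 2.
    by rewrite ler_piMl // sqr_ge0.
  by move=> *; nra.
apply: (@local_lip_segment _ _ (g \- T x)) => t t01; set p := b + _.
have Up : U p by move=> Zp; apply: noZ; exists t.
have px : `|p - x| < d by apply: segment_ball => //; exact: lt_le_trans sd.
have := dT p Up px => /(lip_near_eq (g := g \- T x)) H; apply: lip_near_point; apply: H.
by move: (gU_near p Up); apply: filterS => z /= ->.
Qed.

End SmoothOffClosedSet.

(** * Local extensions and the global one *)

Section SmoothExtension.
Context {R : realType} {V W : normedModType R}.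

Lemma separable_dense_seq : separable V ->
  exists xs : nat -> V, forall x (e : R), 0 < e -> exists n, `|x - xs n| < e.
Proof.
move=> [D /countable_injP[u u_inj] D_dense].
have /choice[xs xsP] : forall n, exists x, forall y, D y -> u y = n -> x = y.
  move=> n; have [[y [Dy <-]]|nD] := pselect (exists y, D y /\ u y = n).
    by exists y => z Dz zy; apply: u_inj; rewrite ?inE.
  by exists 0 => y Dy yn; case: nD; exists y.
exists xs => x e e0.
have [|y [xy Dy]] := D_dense (ball x e) _ (ball_open x e).
  by exists x; exact: ballxx.
by exists (u y); rewrite (xsP _ y) //; move: xy; rewrite -ball_normE.
Qed.

Variable iota : W -> V.
Hypothesis iota_lin : forall a u v, iota (a *: u + v) = a *: iota u + iota v.
Hypothesis iota_norm : forall w, `|iota w| = `|w|.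
Hypothesis iota_closed : closed (range iota).

(** The subspace enters through an isometric linear map with closed range, so its construction as a
    subtype never has to be unfolded. *)
Lemma C1_extension (f : W -> R) : separable V -> admits_C1_norm V -> C1 f ->
  exists g : V -> R, C1 g /\ forall w, g (iota w) = f w.
Proof.
move=> /separable_dense_seq[xs xs_dense] /admits_C1_norm_gauge[N [C [NC C0]]] f_C1.
have fA w : sdiff f w ('d f w) by apply: (C1_on_sdiff openT f_C1).
have iB u v : iota (u - v) = iota u - iota v by exact: iotaB.
have [T [bT cT TA]] := continuous_extension NC C0 xs_dense iota_lin iota_norm iota_closed
  (fun w => (fA w).1) (sdiff_op_continuous fA).
(* A left inverse of [iota], arbitrary off the range, transports [f] and [T] to subsets of [V]. *)
have /choice[p ipK] : forall x, exists w, range iota x -> iota w = x.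
  move=> x; have [[w _ wx]|nx] := pselect (range iota x); first by exists w.
  by exists 0.
have pK w : p (iota w) = w.
  have ipw : iota (p (iota w)) = iota w by apply: ipK; exists w.
  by apply/eqP; rewrite -subr_eq0 -normr_eq0 -iota_norm iB ipw subrr normr0.
(* A radius and a bound for [f] and [T] on that ball. Off the range the ball misses the range and
   the bound is vacuous. *)
have /choice[rK rKP] : forall x, exists rK : R * R, [/\ 0 < rK.1, 0 < rK.2 &
    forall w w', `|iota w - x| < rK.1 -> `|iota w' - x| < rK.1 ->
      `|f w - f w'| <= rK.2 * `|w - w'| /\ forall v, `|T w v| <= rK.2 * `|v|].
  move=> x; have [[w0 _ <-]|nx] := pselect (range iota x).
    have [K1 K10 /near_diag[d1 d10 f1]] := sdiff_lip (fA w0).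
    have [_ [K2 K20 T2]] := bT w0.
    have [d2 d20 T1] := norm_near (cT w0 _ ltr01).
    exists (Num.min d1 d2, K1 + K2 + 1); split => /=; [by rewrite lt_min d10|lra|].
    move=> w w'; rewrite -!iB !iota_norm !lt_min => /andP[w1 w2] /andP[w'1 _]; split.
      rewrite (le_trans (f1 _ _ w1 w'1)) //= ler_wpM2r //; lra.
    move=> v; have h1 := T1 w w2 v; have h2 := T2 v.
    rewrite -(subrK (T w0 v) (T w v)) (le_trans (ler_normD _ _)) //.
    have := normr_ge0 v; nra.
  have : nbhs x (~` range iota).
    by apply: open_nbhs_nbhs; split => //; exact: closed_openC.
  move=> /norm_near[d d0 dn]; exists (d, 1); split => /= [||w w' wx _]; [exact: d0|exact: ltr01|].
  by case: (dn _ wx); exists w.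
have /choice[G GP] : forall x, exists G, smooth G /\
    forall w, `|iota w - x| <= (rK x).1 / 2 -> G (iota w) = f w.
  move=> x; have [r0 K0 rKx] := rKP x.
  (* Half the radius is what the supports of the final partition of unity require, and the closed
     ball keeps [Z] closed. *)
  pose Z := range iota `&` closed_ball_ Num.norm x ((rK x).1 / 2).
  have [Z0|Z0] := pselect (Z !=set0); last first.
    exists (fun=> 0); split=> [|w wx]; first exact: smooth_cst.
    by case: Z0; exists (iota w); split; [exists w|rewrite /closed_ball_ /= distrC].
  have Zr z : Z z -> exists w, iota w = z /\ `|iota w - x| < (rK x).1.
    by move=> [[w _ <-]]; rewrite /closed_ball_ /= distrC => wx; exists w; split => //; lra.
  have [||||F [FE FL FT]] := @whitney_extension R V Z (f \o p) (T \o p) (rK x).2 Z0 K0.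
  - move=> y z /Zr[w [<- wx]] /Zr[w' [<- w'x]] /=.
    rewrite !pK -iB iota_norm.
    exact: (rKx w' w w'x wx).1.
  - by move=> y _; exact: bT.
  - by move=> y /Zr[w [<- wx]] /=; rewrite pK; exact: (rKx w w wx wx).2.
  (* On the range [T] is the derivative of [f], so the Taylor remainder at [w] splits into the
     strict differentiability error at [w0] and the change of derivative from [w0] to [w]. *)
  - move=> y0 e /Zr[w0 [<- _]] e0; have e2 : 0 < e / 2 by rewrite divr_gt0.
    have [_ /(_ _ e2)/near_diag[d1 d10 f1]] := fA w0.
    have [d2 d20 T2] := norm_near (cT w0 _ e2).
    exists (Num.min d1 d2); first by rewrite lt_min d10.
    move=> y z /Zr[w [<- _]] /Zr[w' [<- _]] /=; rewrite !pK -!iB !iota_norm !lt_min.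
    move=> /andP[w1 w2] /andP[w'1 _]; split; last first.
      by move=> v; rewrite (le_trans (T2 w w2 v)) // ler_wpM2r //; lra.
    have := f1 w' w w'1 w1 => /= h1; have := T2 w w2 (iota (w' - w)).
    rewrite !TA iota_norm => h2.
    have lA := linB w' w (fA w0).1.
    rewrite (_ : _ - _ - _ = (f w' - 'd f w0 w' - (f w - 'd f w0 w)) -
      ('d f w (w' - w) - 'd f w0 (w' - w))); last by rewrite lA; ring.
    by rewrite (le_trans (ler_normB _ _)) // (splitr e) mulrDl lerD.
  have Z_closed : closed Z by apply: closedI => //; exact: closed_closed_ball_.
  have [g [sg gF]] := smooth_off_closed NC C0 xs_dense Z_closed FL FT.
  exists g; split => // w wx.
  have Zw : Z (iota w) by split; [exists w|rewrite /closed_ball_ /= distrC].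
  by rewrite gF // FE //= pK.
have T0 : [set: V] !=set0 by exists 0.
have r0 x : [set: V] x -> 0 < (rK x).1 by have [] := rKP x.
have [c [phi [_ phi_s phi0 phi_supp phi_sum]]] :=
  partition_of_unity NC C0 xs_dense T0 r0.
have /choice[k kP] : forall x : V, exists k, \forall z \near x,
    forall n, (k <= n)%N -> \sum_(i < n) phi i z = 1.
  by move=> x; exact: phi_sum.
exists (glue phi k (fun i => G (c i))); split.
  apply: smooth_C1 => x.
  apply: (glue_sdiff openT (fun x _ => kP x)) => // i; first by have [] := phi_s i.
  by have [] := GP (c i).
move=> w; apply/eqP; rewrite -subr_eq0 -normr_le0.
apply: (@convex_sum_le R (fun i => phi i (iota w)) (fun i => G (c i) (iota w))) => //.
  by apply: (nbhs_singleton (kP (iota w))).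
move=> i /phi_supp wi; have [_ ->] := GP (c i); first by rewrite subrr normr0.
exact: ltW.
Qed.

End SmoothExtension.

Theorem theorem3 (R : realType) (X : completeNormedModType R)
    (X_separable : separable X) (X_norm : admits_C1_norm X)
    (Y : submodClosed X) (Y_closed : closed [set x : X | x \in Y])
    (f : subspace_of Y -> R) (f_C1 : C1 f) :
  exists g : X -> R, C1 g /\ forall y : subspace_of Y, g (\val y) = f y.
Proof.
apply: C1_extension => //.
suff -> : range (\val : subspace_of Y -> X) = [set x : X | x \in Y] by [].
apply/seteqP; split=> [_ [y _ <-]|x /= xY]; first exact: (valP y).
by exists (Sub x xY) => //; rewrite SubK.
Qed.
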